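(* Let $T$ be a complete first-order theory with infinite models which has $\mathrm{SU}$-rank one, and let $\mathbb{M}$ be the monster model of $T$. If $(\mathbb{M},\mathbb{H})$ is the monster model of the theory $T^{\mathrm{indep}}$ of $H$-structures of $T$, then $e(\mathbb{H})\neq o(\mathbb{H})$.
   Context: Conventions. $T$ is a complete first-order theory in a language $L$ with an infinite model. Fix a strongly inaccessible cardinal $\lambda>|L|$; the monster model of a complete theory is its saturated model of cardinality $\lambda$ (unique up to isomorphism), and ''small'' means of cardinality $<\lambda$. For $\mathbb{D}\subseteq\mathbb{M}$, $(\mathbb{M},\mathbb{D})$ is the expansion of $\mathbb{M}$ by a new predicate interpreted as $\mathbb{D}$, and $o(\mathbb{D})=\{\mathbb{D}'\subseteq\mathbb{M}\mid(\mathbb{M},\mathbb{D})\cong(\mathbb{M},\mathbb{D}')\}=\{f(\mathbb{D})\mid f\in\mathrm{Aut}(\mathbb{M})\}$, $e(\mathbb{D})=\{\mathbb{D}'\subseteq\mathbb{M}\mid(\mathbb{M},\mathbb{D})\equiv(\mathbb{M},\mathbb{D}')\}$. $T$ has $\mathrm{SU}$-rank one if it is simple and the formula $x=x$ ($x$ a single variable) has $\mathrm{SU}$-rank $1$ (so non-algebraic $1$-types have $\mathrm{SU}$-rank $1$). Such theories are geometric: $\mathrm{acl}$ satisfies exchange in models of $T$ and $T$ eliminates the quantifier $\exists^\infty$. $H$-structures. Let $T$ be geometric and $L_H=L\cup\{H\}$ with $H$ a new unary predicate. An $L_H$-structure $(M,H(M))$ with $M\models T$ is an $H$-structure if $H(M)$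 is an algebraically independent set and: (Density) for every finite $A\subseteq M$, every non-algebraic $L$-type $q(x)\in S_1(A)$ has a realization in $H(M)$; (Extension) for every finite $A\subseteq M$, every non-algebraic $L$-type $q(x)\in S_1(A)$ has a realization $a\in M$ with $a\notin\mathrm{acl}(A\cup H(M))$. Here $\mathrm{acl}$ is in the sense of $L$. All $H$-structures of $T$ are elementarily equivalent; their common complete theory is denoted $T^{\mathrm{indep}}$ (the theory of $H$-structures of $T$). It is axiomatized by $T$ together with: the elements of $H$ are algebraically independent; if $\varphi(\bar a,x)$ ($\varphi\in L$) has infinitely many solutions, it has a solution in $H$; if $\varphi(\bar a,x)$ has infinitely many solutions and, for every $\bar y$, $\psi(\bar a,\bar y,x)$ has fewer than $k$ solutions, then some solution $x$ of $\varphi(\bar a,x)$ satisfies $\neg\psi(\bar a,\bar y,x)$ for all $\bar y$ from $H$ ($\varphi,\psi\in L$). Every $\omega$-saturated model of $T^{\mathrm{indep}}$ is an $H$-structure. The $L$-reduct of the monster model of $T^{\mathrm{indep}}$ is identified with $\mathbb{M}$, and $\mathbb{H}=H(\mathbb{M})$. *)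

(* Defs.v *)
From mathcomp Require Import all_boot.
From mathcomp Require Import boolp classical_sets functions cardinality.

Set Implicit Arguments.
Unset Strict Implicit.
Unset Printing Implicit Defensive.

Local Open Scope classical_set_scope.
Local Open Scope card_scope.

Definition card_lt (T U : Type) (A : set T) (B : set U) : Prop :=
  A #<= B /\ ~ (B #<= A).

Notation "A '#<' B" := (card_lt A B)
  (at level 79, format "A  '#<'  B") : card_scope.

(* A cardinal is represented by a type [K] of that cardinality. *)
Definition strongly_inaccessible (K : Type) : Prop :=
  [/\ ~ countable [set: K],
      (forall A : set K, A #< [set: K] ->
         [set B : set K | B `<=` A] #< [set: K]) &
      (forall (I : set K) (F : K -> set K),
         I #< [set: K] -> (forall i, I i -> F i #< [set: K]) ->
         \bigcup_(i in I) F i #< [set: K])].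

Record language := Language {
  funs : Type;
  fun_arity : funs -> nat;
  rels : Type;
  rel_arity : rels -> nat }.

(* Constants are function symbols of arity 0. Against an uncountable cardinal,
   comparing the number of symbols or the number of formulas is the same. *)
Definition symbols (L : language) : Type := (funs L + rels L)%type.

(* [term L n] and [formula L n] have their free variables indexed by ['I_n]. *)
Inductive term (L : language) (n : nat) : Type :=
| Var of 'I_n
| App (f : funs L) of ('I_(fun_arity f) -> term L n).

Inductive formula (L : language) : nat -> Type :=
| Falsum n : formula L n
| Equal n of term L n & term L n : formula L n
| Rel n (r : rels L) of ('I_(rel_arity r) -> term L n) : formula L n
| Imp n of formula L n & formula L n : formula L n
| All n of formula L n.+1 : formula L n.

Arguments Var {L n}.
Arguments App {L n}.
Arguments Falsum {L n}.
Arguments Equal {L n}.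
Arguments Rel {L n}.
Arguments Imp {L n}.
Arguments All {L n}.

Definition Neg (L : language) (n : nat) (phi : formula L n) : formula L n :=
  Imp phi Falsum.

Definition theory (L : language) : Type := set (formula L 0).

Record structure (L : language) := Structure {
  carrier :> Type;
  carrier_inhabited : inhabited carrier;
  fun_interp : forall f : funs L, ('I_(fun_arity f) -> carrier) -> carrier;
  rel_interp : forall r : rels L, ('I_(rel_arity r) -> carrier) -> Prop }.

Arguments fun_interp {L} s f _.
Arguments rel_interp {L} s r _.

Definition vnil (X : Type) (i : 'I_0) : X :=
  let: Ordinal _ lt_i0 := i in False_rect X (notF lt_i0).

(* [vcons a v] puts [a] at index [ord0], the variable bound by [All]. *)
Definition vcons (X : Type) (n : nat) (a : X) (v : 'I_n -> X) : 'I_n.+1 -> X :=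
  fun i => oapp v a (unlift ord0 i).

Definition vcat (X : Type) (n m : nat) (v : 'I_n -> X) (w : 'I_m -> X) :
    'I_(n + m) -> X :=
  fun i => match fintype.split i with inl j => v j | inr k => w k end.

Fixpoint eval (L : language) (M : structure L) (n : nat) (v : 'I_n -> M)
    (t : term L n) : M :=
  match t with
  | Var i => v i
  | App f ts => fun_interp M f (fun i => eval v (ts i))
  end.

Fixpoint sat (L : language) (M : structure L) (n : nat) (phi : formula L n) :
    ('I_n -> M) -> Prop :=
  match phi with
  | Falsum _ => fun _ => False
  | Equal _ s t => fun v => eval v s = eval v t
  | Rel _ r ts => fun v => rel_interp M r (fun i => eval v (ts i))
  | Imp _ phi psi => fun v => sat phi v -> sat psi v
  | All _ phi => fun v => forall a : M, sat phi (vcons a v)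
  end.

Definition holds (L : language) (M : structure L) (phi : formula L 0) : Prop :=
  sat phi (@vnil M).

Definition models (L : language) (T : theory L) (M : structure L) : Prop :=
  forall phi, T phi -> holds M phi.

Definition entails (L : language) (T : theory L) (phi : formula L 0) : Prop :=
  forall M : structure L, models T M -> holds M phi.

Definition complete_theory (L : language) (T : theory L) : Prop :=
  (exists M : structure L, models T M) /\
  (forall phi, entails T phi \/ entails T (Neg phi)).

Definition has_infinite_model (L : language) (T : theory L) : Prop :=
  exists M : structure L, models T M /\ infinite_set [set: M].

Definition elem_equiv (L : language) (M N : structure L) : Prop :=
  forall phi : formula L 0, holds M phi <-> holds N phi.

Definition isomorphism (L : language) (M N : structure L) (h : M -> N) : Prop :=
  [/\ bijective h,
      (forall (f : funs L) (v : 'I_(fun_arity f) -> M),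
         h (fun_interp M f v) = fun_interp N f (h \o v)) &
      (forall (r : rels L) (v : 'I_(rel_arity r) -> M),
         rel_interp M r v <-> rel_interp N r (h \o v))].

Definition isomorphic (L : language) (M N : structure L) : Prop :=
  exists h : M -> N, isomorphism h.

(* [PFormula phi b] is phi(x, b), with x of length n and b a tuple from M. *)
Record pformula (L : language) (M : structure L) (n : nat) := PFormula {
  plen : nat;
  pbody : formula L (n + plen);
  pparam : 'I_plen -> M }.

Arguments PFormula {L M n plen}.
Arguments plen {L M n}.
Arguments pbody {L M n}.
Arguments pparam {L M n}.

Section Types.
Context (L : language) (M : structure L).

Definition over (A : set M) (n : nat) (phi : pformula M n) : Prop :=
  forall i, A (pparam phi i).

Definition psat (n : nat) (phi : pformula M n) (x : 'I_n -> M) : Prop :=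
  sat (pbody phi) (vcat x (pparam phi)).

Definition pneg (n : nat) (phi : pformula M n) : pformula M n :=
  PFormula (Neg (pbody phi)) (pparam phi).

Definition realizes (n : nat) (p : set (pformula M n)) (x : 'I_n -> M) : Prop :=
  forall phi, p phi -> psat phi x.

(* [complete_type A p] : p belongs to S_n(A), computed in Th(M, a)_(a in A). *)
Definition complete_type (n : nat) (A : set M) (p : set (pformula M n)) : Prop :=
  [/\ (forall phi, p phi -> over A phi),
      (forall F : set (pformula M n), F `<=` p -> finite_set F ->
         exists x, realizes F x) &
      (forall phi, over A phi -> p phi \/ p (pneg phi))].

Definition same_type (n : nat) (A : set M) (x y : 'I_n -> M) : Prop :=
  forall phi : pformula M n, over A phi -> (psat phi x <-> psat phi y).

Definition algebraic (phi : pformula M 1) : Prop :=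
  finite_set [set x : 'I_1 -> M | psat phi x].

Definition nonalgebraic_type (p : set (pformula M 1)) : Prop :=
  forall phi, p phi -> ~ algebraic phi.

Definition acl (A : set M) : set M :=
  [set a | exists phi : pformula M 1,
     [/\ over A phi, algebraic phi & psat phi (fun=> a)]].

Definition alg_independent (H : set M) : Prop :=
  forall h, H h -> ~ acl (H `\ h) h.

End Types.

(* Saturated of cardinality exactly K. *)
Definition saturated (K : Type) (L : language) (M : structure L) : Prop :=
  [set: M] #= [set: K] /\
  forall (A : set M) (p : set (pformula M 1)),
    A #< [set: K] -> complete_type A p -> exists x, realizes p x.

Definition monster (K : Type) (L : language) (T : theory L) (M : structure L) :
    Prop :=
  models T M /\ saturated K M.

(* The formula phi(x; y) has the tree property with respect to T. The tree of
   parameters is indexed by finite sequences of naturals (its root is unused).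
   A branch is consistent when it is finitely satisfiable in the model. *)
Definition tree_property (L : language) (T : theory L) (n m : nat)
    (phi : formula L (n + m)) : Prop :=
  exists (M : structure L) (a : seq nat -> 'I_m -> M) (k : nat),
  [/\ models T M,
      (forall (s : seq nat) (i : 'I_k -> nat), injective i ->
         ~ exists x : 'I_n -> M, forall j, sat phi (vcat x (a (rcons s (i j))))) &
      (forall (sigma : nat -> nat) (l : nat),
         exists x : 'I_n -> M, forall j, (j < l)%N ->
           sat phi (vcat x (a (mkseq sigma j.+1))))].

Definition simple (L : language) (T : theory L) : Prop :=
  forall (n m : nat) (phi : formula L (n + m)), ~ tree_property T phi.

(* Dividing, forking and SU-rank are meant for M a monster model and for
   small sets of parameters. *)
Section Forking.
Context (L : language) (M : structure L).

Definition divides (n : nat) (A : set M) (phi : pformula M n) : Prop :=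
  exists (k : nat) (b : nat -> 'I_(plen phi) -> M),
    (forall i, same_type A (b i) (pparam phi)) /\
    (forall i : 'I_k -> nat, injective i ->
       ~ exists x, forall j, psat (PFormula (pbody phi) (b (i j))) x).

(* A (small) partial type forks over A if it implies a finite disjunction of
   formulas that divide over A; implication is tested in M by saturation. *)
Definition forks (n : nat) (A : set M) (p : set (pformula M n)) : Prop :=
  exists (l : nat) (psi : 'I_l -> pformula M n),
    (forall i, divides A (psi i)) /\
    (forall x, realizes p x -> exists i, psat (psi i) x).

(* SU(p) >= r for p in S_n(A). Only finite values of the rank are needed. *)
Fixpoint SU_ge (K : Type) (n r : nat) (A : set M) (p : set (pformula M n)) :
    Prop :=
  match r with
  | 0 => complete_type A p
  | r'.+1 => complete_type A p /\
      exists (B : set M) (q : set (pformula M n)),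
        [/\ A `<=` B, B #< [set: K], p `<=` q, forks A q & SU_ge K r' B q]
  end.

(* SU(phi) is the supremum of SU(p) over the p in S_n(A) containing phi. *)
Definition SU_formula_ge (K : Type) (n r : nat) (A : set M)
    (phi : pformula M n) : Prop :=
  exists p : set (pformula M n), p phi /\ SU_ge K r A p.

Definition SU_formula_eq (K : Type) (n r : nat) (A : set M)
    (phi : pformula M n) : Prop :=
  SU_formula_ge K r A phi /\ ~ SU_formula_ge K r.+1 A phi.

Definition x_eq_x : pformula M 1 :=
  @PFormula L M 1 0 (Equal (Var ord0) (Var ord0)) (@vnil M).

End Forking.

(* The monster model is unique up to isomorphism, so quantifying over all
   monster models of T of cardinality K is a property of T. *)
Definition SU_rank_one (K : Type) (L : language) (T : theory L) : Prop :=
  simple T /\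
  forall M : structure L, monster K T M -> SU_formula_eq K 1 set0 (x_eq_x M).

(* [None] is the new predicate symbol. *)
Definition add_pred (L : language) : language := {|
  funs := funs L;
  fun_arity := @fun_arity L;
  rels := option (rels L);
  rel_arity := fun r => if r is Some r' then rel_arity r' else 1 |}.

Definition expand (L : language) (M : structure L) (D : set M) :
    structure (add_pred L) := {|
  carrier := M;
  carrier_inhabited := carrier_inhabited M;
  fun_interp := fun f : funs (add_pred L) => fun_interp M f;
  rel_interp := fun r : rels (add_pred L) =>
    match r return ('I_(@rel_arity (add_pred L) r) -> M) -> Prop with
    | Some r' => rel_interp M r'
    | None => fun v => D (v ord0)
    end |}.

(* Type-theoretic notions ([acl], types) refer to the L-structure M. *)
Definition H_structure (L : language) (T : theory L) (M : structure L)
    (H : set M) : Prop :=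
  [/\ models T M,
      alg_independent H,
      (forall (A : set M) (q : set (pformula M 1)), finite_set A ->
         complete_type A q -> nonalgebraic_type q ->
         exists a : M, H a /\ realizes q (fun=> a)) &
      (forall (A : set M) (q : set (pformula M 1)), finite_set A ->
         complete_type A q -> nonalgebraic_type q ->
         exists a : M, realizes q (fun=> a) /\ ~ acl (A `|` H) a)].

Definition Tindep (L : language) (T : theory L) : theory (add_pred L) :=
  [set phi | forall (M : structure L) (H : set M),
     H_structure T H -> holds (expand H) phi].

Definition orbit_class (L : language) (M : structure L) (D : set M) :
    set (set M) :=
  [set D' | isomorphic (expand D) (expand D')].

Definition elem_class (L : language) (M : structure L) (D : set M) :
    set (set M) :=
  [set D' | elem_equiv (expand D) (expand D')].

(* Main.v *)
Require Import Defs.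
From mathcomp Require Import all_boot.
From mathcomp Require Import boolp classical_sets functions cardinality.
From mathcomp Require Import wochoice filter.
From Stdlib Require Inverse_Image.

(** A set D for which (M,D) is an H-structure satisfies (M,D) = (M,H) elementarily,
    by back and forth between tuples v such that the rest of D is independent
    over v; so it is enough to find such a D for which (M,D) is not saturated,
    that is, for which D omits a non-algebraic type over a small set.  Count
    the global non-algebraic types.

    If there are few, a small set C of parameters separates them, every type
    over C is stationary, and D can be taken small: it collects infinitely many
    independent realizations of each type over C.  Then D omits {x <> d | d in D}.

    If there are many, one of them, g, restricts to a type q over a small set C
    that no type over a finite set implies up to algebraicity.  Otherwise there
    would be a large family of non-algebraic types over finite sets that are
    pairwise contradictory up to algebraicity, whence by Erdos-Rado an infinite
    family of conjugate infinite sets with pairwise intersections of bounded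
    size; in rank one this is impossible, because infinitely many conjugates of
    an infinite definable set never form a k-inconsistent family.  Building D
    by transfinite recursion one can then avoid all realizations of q. *)

Set Implicit Arguments.
Unset Strict Implicit.
Unset Printing Implicit Defensive.

Local Open Scope classical_set_scope.
Local Open Scope card_scope.

(** If e(H) = o(H), every H-structure (M,D) is isomorphic to (M,H), hence saturated, and density
    improves from finite to small sets of parameters. Both constructions of D refute this. Neither
    construction suffices alone. A small D that is dense over finite sets bounds the number of
    global non-algebraic types, because each of them is determined by an ultrafilter on D.
    Conversely, in a strongly minimal theory the non-algebraic type over the empty set implies, up
    to algebraicity, every restriction of the unique global one, so a generically chosen point
    realizes them all. The rank-one fact about conjugates of an infinite definable set serves twice:
    it also yields exchange for [acl]. Exchange is proved in every model of T, not only in M,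
    because [Tindep] speaks of all H-structures. Inaccessibility keeps the iterated power sets
    required by Erdos-Rado small. *)

Definition eps (T : Type) (t0 : T) (P : set T) : T :=
  if pselect (exists t, P t) is left h then sval (cid h) else t0.

Lemma epsP (T : Type) (t0 : T) (P : set T) : (exists t, P t) -> P (eps t0 P).
Proof. by rewrite /eps; case: pselect => // h _; case: cid. Qed.

(** * Cardinals *)

Lemma card_eq_leW (T U : Type) (A : set T) (B : set U) : A #= B -> A #<= B.
Proof. by rewrite card_eq_le => /andP[]. Qed.

Lemma card_le_inj (T U : Type) (A : set T) (B : set U) (f : T -> U) :
  (forall x, A x -> B (f x)) ->
  (forall x y, A x -> A y -> f x = f y -> x = y) -> A #<= B.
Proof.
move=> fAB finj; apply: (@card_le_trans _ _ _ (f @` A)).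
  apply: card_eq_leW; rewrite card_eq_sym; apply: inj_card_eq => x y /set_mem Ax /set_mem Ay.
  exact: finj.
by apply: subset_card_le => _ [x Ax <-]; exact: fAB.
Qed.

Lemma card_le_inj_ex (T U : Type) (A : set T) (B : set U) (u0 : U) : A #<= B ->
  exists f : T -> U, (forall x, A x -> B (f x)) /\
    (forall x y, A x -> A y -> f x = f y -> x = y).
Proof.
elim/Ppointed: U => U in B u0 *; first by have := no u0.
move=> /pcard_leP /injfunPex [f fAB finj]; exists f; split => // x y Ax Ay.
by apply: finj; apply/mem_set.
Qed.

Lemma card_leT_inj (T U : Type) (f : T -> U) : injective f -> [set: T] #<= [set: U].
Proof. by move=> fI; apply: (@card_le_inj _ _ _ _ f) => // x y _ _ /fI. Qed.

Lemma card_leT_inj_ex (T U : Type) (u0 : U) : [set: T] #<= [set: U] ->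
  exists f : T -> U, injective f.
Proof.
by move=> /(card_le_inj_ex u0) [f [_ fI]]; exists f => x y; exact: fI.
Qed.

Lemma not_card_le_powerset (T : Type) : ~ ([set: set T] #<= [set: T]).
Proof.
have [t0|noT] := pselect (inhabited T).
  case: t0 => t0 /(card_leT_inj_ex t0) [f fI].
  pose D : set T := [set t | exists2 X, t = f X & ~ X t].
  have [Df|nDf] := pselect (D (f D)).
    by case: (Df) => X /fI <- /(_ Df).
  by apply: (nDf); exists D.
move=> /card_leP [f]; have [t _] := f (SigSub (mem_set I : (set0 : set T) \in setT)).
by apply: noT; exists.
Qed.

Record well_order_rel (T : Type) (lt : T -> T -> Prop) : Prop := WellOrderRel {
  wo_wf : well_founded lt;
  wo_trans : forall x y z, lt x y -> lt y z -> lt x z;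
  wo_total : forall x y, [\/ lt x y, x = y | lt y x] }.

Section WellOrder.
Context (T : Type) (lt : T -> T -> Prop).
Hypothesis lt_wo : well_order_rel lt.

Lemma wo_irr x : ~ lt x x.
Proof.
by elim: (wo_wf lt_wo x) => y _ IH /[dup]/IH.
Qed.

Lemma wo_min (P : T -> Prop) : (exists x, P x) ->
  exists x, P x /\ forall y, lt y x -> ~ P y.
Proof.
move=> [x Px]; apply: contrapT => noM.
suff : forall x, ~ P x by apply; exact: Px.
move=> {x Px}; apply: (well_founded_ind (wo_wf lt_wo)) => x IH Px.
by apply: noM; exists x.
Qed.

End WellOrder.

Lemma wo_of_min (T : Type) (lt : T -> T -> Prop) :
  (forall x, ~ lt x x) -> (forall x y z, lt x y -> lt y z -> lt x z) ->
  (forall x y, [\/ lt x y, x = y | lt y x]) ->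
  (forall P : set T, P !=set0 -> exists x, P x /\ forall y, lt y x -> ~ P y) ->
  well_order_rel lt.
Proof.
move=> irr tr tot min; split; [|exact: tr|exact: tot].
move=> x; apply: contrapT => nA.
have [y [nAy yM]] := min [set x | ~ Acc lt x] (ex_intro _ x nA).
by apply: nAy; split => z /yM /contrapT.
Qed.

(** The relation R of the well-ordering principle comes only with unique least elements of nonempty
    sets. Sets of one, two and three elements give reflexivity, antisymmetry, totality and
    transitivity; the order sought is the strict part of R. *)
Lemma wo_exists (T : Type) : exists lt : T -> T -> Prop, well_order_rel lt.
Proof.
have [R Rwo] := well_ordering_principle {classic T}.
have min (P : set T) : P !=set0 -> exists x, P x /\ forall y, P y -> R x y.
  move=> [x Px]; have [|z [[zP zM] _]] := Rwo (fun t => t \in P).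
    by exists x; exact/mem_set.
  exists z; split; first exact/set_mem.
  by move=> y Py; apply: zM; exact/mem_set.
have refl x : R x x.
  by have [|z [-> zM]] := min [set x]; [exists x | exact: zM].
have anti x y : R x y -> R y x -> x = y.
  move=> xy yx; have [|z [_ zu]] := Rwo (fun t => t \in [set x; y]).
    by exists x; apply/mem_set; left.
  rewrite -(zu x) ?(zu y) //.
  - split; first by apply/mem_set; right.
    by move=> u /set_mem [] -> //; exact: refl.
  - split; first by apply/mem_set; left.
    by move=> u /set_mem [] -> //; exact: refl.
have tot x y : R x y \/ R y x.
  have [|z [[->|->] zM]] := min [set x; y]; first by exists x; left.
    by left; apply: zM; right.
  by right; apply: zM; left.
have tr x y z : R x y -> R y z -> R x z.
  move=> xy yz.
  have [|u [ux uM]] := min [set t | [\/ t = x, t = y | t = z]].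
    by exists x; constructor 1.
  have ux' : R u x by apply: uM; constructor 1.
  have uy' : R u y by apply: uM; constructor 2.
  have uz' : R u z by apply: uM; constructor 3.
  case: ux => ue; subst u => //; first by rewrite (anti x y).
  by rewrite (anti z y) // in xy *.
exists (fun x y => R x y /\ x <> y); apply: wo_of_min.
- by move=> x [].
- move=> x y z [xy nxy] [yz nyz]; split; first exact: tr yz.
  by move=> xz; subst z; apply: nxy; exact: anti.
- move=> x y; have [->|xy] := pselect (x = y); first by constructor 2.
  by have [?|?] := tot x y; [constructor 1|constructor 3; split => // /esym].
- move=> P /min [x [Px xM]]; exists x; split => // y [yx nyx] Py.
  by apply: nyx; apply: anti => //; exact: xM.
Qed.

(* The injection is f x := some element of B not yet used below x. *)
Lemma wo_inj_or_surj (T U : Type) (lt : T -> T -> Prop) (B : set U) :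
  well_order_rel lt ->
  (exists f : T -> U, injective f /\ forall x, B (f x)) \/
  (exists x, B #<= [set y | lt y x]).
Proof.
move=> two.
have [[x Bx]|nB] := pselect (exists x, B #<= [set y | lt y x]); first by right; exists x.
left.
have [[x0 _]|noT] := pselect (exists x : T, True); last first.
  have f : T -> U by move=> x; case: noT; exists x.
  by exists f; split => [x|x]; case: noT; exists x.
have [[u0 _]|noU] := pselect (exists u : U, B u); last first.
  exfalso; apply: nB; exists x0; rewrite (_ : B = set0) //.
  by apply/seteqP; split => // u Bu; apply: noU; exists u.
pose F x (g : forall y, lt y x -> U) : U :=
  eps u0 [set u | B u /\ forall y (yx : lt y x), g y yx <> u].
pose f := Fix (wo_wf two) (fun _ => U) F.
have fE x : f x = eps u0 [set u | B u /\ forall y, lt y x -> f y <> u].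
  rewrite /f Fix_eq // => {}x g h gh; rewrite /F.
  congr eps; apply/seteqP; split => u [Bu uN]; split => // y yx.
    by rewrite -gh.
  by rewrite gh.
have fP x : B (f x) /\ forall y, lt y x -> f y <> f x.
  have [ex|no] := pselect (exists u, B u /\ forall y, lt y x -> f y <> u).
    by rewrite fE; exact: (epsP u0 ex).
  exfalso; apply: nB; exists x.
  have sub : B `<=` f @` [set y | lt y x].
    move=> u Bu; apply: contrapT => nu; apply: no; exists u; split => // y yx fyu.
    by apply: nu; exists y.
  by apply: card_le_trans (subset_card_le sub) _; exact: card_image_le.
exists f; split; last by move=> x; have [] := fP x.
move=> x y fxy; have [xy|//|yx] := wo_total two x y.
  by have [_ /(_ _ xy)] := fP y.
by have [_ /(_ _ yx)] := fP x; rewrite fxy.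
Qed.

Lemma card_le_total (T U : Type) (A : set T) (B : set U) : A #<= B \/ B #<= A.
Proof.
have [lt ltwo] := wo_exists A.
have [[f [fI fB]]|[x Bx]] := wo_inj_or_surj B ltwo.
  left; rewrite (card_le_eql (card_setT_sym A)).
  by apply: (@card_le_inj _ _ _ _ f) => // x y _ _ /fI.
right; apply: (card_le_trans Bx).
by apply: (card_le_trans (subset_card_le (@subsetT _ _))); exact: card_eq_leW.
Qed.

Lemma well_order_rel_inj (T U : Type) (lt : U -> U -> Prop) (f : T -> U) :
  well_order_rel lt -> injective f -> well_order_rel (fun x y => lt (f x) (f y)).
Proof.
move=> uwo fI; split.
- exact: (Inverse_Image.wf_inverse_image _ _ _ f (wo_wf uwo)).
- by move=> x y z; exact: (wo_trans uwo).
- move=> x y; case: (wo_total uwo (f x) (f y)) => [?|/fI ?|?];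
    [constructor 1|constructor 2|constructor 3] => //.
Qed.

Section Small.
Context (K : Type).
Hypothesis K_inacc : strongly_inaccessible K.

Definition small (T : Type) (A : set T) : Prop := A #< [set: K].

Lemma small_le (T U : Type) (A : set T) (B : set U) : small B -> A #<= B -> small A.
Proof.
move=> [BK nKB] AB; split; first exact: card_le_trans BK.
by move=> KA; apply: nKB; exact: card_le_trans AB.
Qed.

Lemma small_sub (T : Type) (A B : set T) : small B -> A `<=` B -> small A.
Proof. by move=> sB /subset_card_le; exact: small_le. Qed.

Lemma small_image (T U : Type) (f : T -> U) (A : set T) : small A -> small (f @` A).
Proof. by move=> sA; apply: small_le sA _; exact: card_image_le. Qed.

Lemma small_inj (T U : Type) (f : T -> U) : injective f ->
  small [set: U] -> small [set: T].
Proof. by move=> fI sU; apply: small_le sU _; exact: card_leT_inj fI. Qed.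

Lemma small_subT (T : Type) (A : set T) : small [set: T] -> small A.
Proof. by move=> sT; apply: small_sub sT _. Qed.

Lemma small_set_type (T : Type) (A : set T) : small A <-> small [set: A].
Proof.
by split=> sA; apply: small_le sA _; apply: card_eq_leW => //; exact: card_esym.
Qed.

Lemma small_range (T U : Type) (f : T -> U) : small [set: T] -> small (range f).
Proof. exact: small_image. Qed.

Lemma K_inhabited : inhabited K.
Proof.
case: K_inacc => ncK _ _; apply: contrapT => noK; apply: ncK.
rewrite (_ : [set: K] = set0) //; apply/seteqP; split => // k _.
by apply: noK; exists.
Qed.

Lemma small_nat : small [set: nat].
Proof.
case: K_inacc => ncK _ _; split => //.
by apply/infiniteP => /finite_set_countable.
Qed.

Lemma small_finite (T : Type) (A : set T) : finite_set A -> small A.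
Proof. by move=> /finite_set_countable; exact: small_le small_nat. Qed.

Lemma not_smallP (T : Type) (A : set T) : ~ small A -> [set: K] #<= A.
Proof.
move=> nA; have [AK|//] := card_le_total A [set: K].
by apply: contrapT => nKA; apply: nA.
Qed.

Lemma small_image_K (T : Type) (A : set T) : small A ->
  exists f : T -> K, (forall x y, A x -> A y -> f x = f y -> x = y) /\ small (f @` A).
Proof.
move=> sA; case: (sA) => AK _; case: K_inhabited => k0.
have [f [_ fI]] := card_le_inj_ex k0 AK.
by exists f; split => //; exact: small_image.
Qed.

Lemma small_powerset (T : Type) : small [set: T] -> small [set: set T].
Proof.
move=> sT; have [f [fI sf]] := small_image_K sT.
case: K_inacc => _ /(_ _ sf) sP _; apply: small_le sP _.
apply: (@card_le_inj _ _ _ _ (fun X => f @` X)) => [X _|X Y _ _ fXY].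
  by move=> _ [x _ <-]; exists x.
have sub X' Y' : f @` X' = f @` Y' -> X' `<=` Y'.
  move=> e x Xx; have : (f @` Y') (f x) by rewrite -e; exists x.
  by move=> [y Yy /fI <-].
by apply/seteqP; split; apply: sub.
Qed.

(** Kuratowski pairs embed the product into the double power set of a small set A that contains
    copies of both factors. *)
Lemma small_prod (T U : Type) : small [set: T] -> small [set: U] -> small [set: T * U].
Proof.
move=> sT sU; have [f [fI sf]] := small_image_K sT.
have [g [gI sg]] := small_image_K sU.
pose A := f @` [set: T] `|` g @` [set: U].
have sA : small A.
  case: K_inacc => _ _ sB; case: K_inhabited => k0.
  have [nK _] := small_nat; have [h hI] := card_leT_inj_ex k0 nK.
  (* A union of two sets is a union indexed by a two-element subset of K, as the regularity clause
     requires. *)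
  have := sB [set h 0; h 1] (fun k => if pselect (k = h 0) then f @` setT else g @` setT).
  have e : h 1 <> h 0 by move=> /hI.
  case=> //.
  - by apply: small_finite; exact: finite_set2.
  - by move=> k _; case: pselect.
  - move=> BK nKB; apply: (@small_sub _ _ (\bigcup_(k in [set h 0; h 1])
      (if pselect (k = h 0) then f @` setT else g @` setT))); first by split.
    move=> k [fk|gk]; first by exists (h 0); [left|case: pselect => // /(_ erefl)].
    by exists (h 1); [right|case: pselect => // /e].
have sPA : small [set: set (set A)].
  by apply: small_powerset; apply: small_powerset; exact: (iffLR (small_set_type A) sA).
pose a (x : T) : A := SigSub (mem_set (or_introl (ex_intro2 _ _ x I erefl)) : f x \in A).
pose b (y : U) : A := SigSub (mem_set (or_intror (ex_intro2 _ _ y I erefl)) : g y \in A).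
have aI : injective a by move=> x y /(congr1 val) /= /fI; apply.
have bI : injective b by move=> x y /(congr1 val) /= /gI; apply.
apply: (@small_inj _ _ (fun p : T * U => [set [set a p.1]; [set a p.1; b p.2]])) sPA.
move=> [x y] [x' y'] /= e.
have e1 : [set a x] = [set a x'].
  have : [set [set a x']; [set a x'; b y']] [set a x] by rewrite -e; left.
  case=> // e1; have : [set a x] (a x') by rewrite e1; left.
  by move=> ->.
have /aI xx : a x = a x' by have : [set a x'] (a x) by rewrite -e1.
rewrite -xx in e *; congr pair.
have : [set [set a x]; [set a x; b y']] [set a x; b y] by rewrite -e; right.
case=> e2.
  have : [set [set a x]; [set a x; b y]] [set a x; b y'] by rewrite e; right.
  rewrite e2 => -[e3|e3]; apply: bI;
  (have : [set a x] (b y') by rewrite -e3; right);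
  (have : [set a x] (b y) by rewrite -e2; right); by move=> -> ->.
apply: bI; have : [set a x; b y'] (b y) by rewrite -e2; right.
case=> // bya; have : [set a x; b y] (b y') by rewrite e2; right.
by case=> // ->.
Qed.

Lemma small_fun (T U : Type) : small [set: T] -> small [set: U] -> small [set: T -> U].
Proof.
move=> sT sU; have := small_powerset (small_prod sT sU).
apply: (@small_inj _ _ (fun f => [set p : T * U | f p.1 = p.2])) => f g e.
apply/funext => x; have : [set p : T * U | f p.1 = p.2] (x, f x) by [].
by rewrite e /= => ->.
Qed.

Lemma small_bool : small [set: bool].
Proof. exact/small_finite/finite_finset. Qed.

Lemma small_option (T : Type) : small [set: T] -> small [set: option T].
Proof.
move=> /small_powerset; apply: (@small_inj _ _ (fun o => [set x | o = Some x])).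
move=> [x|] [y|] //= e.
- by have : [set z | Some x = Some z] x by []; rewrite e.
- by have : [set z | Some x = Some z] x by []; rewrite e.
- by have : [set z | Some y = Some z] y by []; rewrite -e.
Qed.

Lemma small_sum (T U : Type) : small [set: T] -> small [set: U] -> small [set: T + U].
Proof.
move=> sT sU; have := small_prod (small_option sT) (small_option sU).
apply: (@small_inj _ _ (fun s => match s with inl x => (Some x, None) | inr y => (None, Some y) end)).
by move=> [x|y] [x'|y'] //= [->].
Qed.

(** The regularity clause concerns subsets of K, so each [F i] is copied into K by an injection
    [e i]. A point x of the union is then recovered from the pair of i and [e i x]. *)
Lemma small_bigcup (I T : Type) (A : set I) (F : I -> set T) :
  small A -> (forall i, A i -> small (F i)) -> small (\bigcup_(i in A) F i).
Proof.
move=> sA sF; case: K_inhabited => k0.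
have /choice [e eP] : forall i, exists e : T -> K, A i ->
    (forall x y, F i x -> F i y -> e x = e y -> x = y) /\ small (e @` F i).
  move=> i; have [Ai|nAi] := pselect (A i); last by exists (fun=> k0).
  by have [f fP] := small_image_K (sF i Ai); exists f.
have [f [fI sf]] := small_image_K sA.
(* The inner union has one index only, as [f] is injective on A; it serves to index the family by
   elements of K. *)
pose B := \bigcup_(k in f @` A) \bigcup_(i in [set i | A i /\ f i = k]) (e i @` F i).
have sB : small B.
  case: K_inacc => _ _; apply => // _ [i Ai <-].
  have [_ sFi] := eP i Ai; apply: small_sub sFi _.
  by move=> k [j [Aj /fI ->]].
have := small_prod (iffLR (small_set_type A) sA) (iffLR (small_set_type B) sB).
have [[x0 [i0 Ai0 Fx0]]|no] := pselect (exists x, (\bigcup_(i in A) F i) x); last first.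
  move=> _; rewrite (_ : \bigcup_(i in A) F i = set0); first exact: small_finite.
  by apply/seteqP; split => // x Fx; apply: no; exists x.
move=> sAB; apply: (@small_le _ _ _ (@setT T `&` \bigcup_(i in A) F i)); last first.
  by apply: subset_card_le => x.
pose G (p : A * B) := eps x0 [set x | F (val p.1) x /\ e (val p.1) x = val p.2].
apply: small_sub (small_range G sAB) _ => x [_ [i Ai Fx]].
have Bx : B (e i x) by exists (f i); [exists i|exists i => //; exists x].
exists (SigSub (mem_set Ai), SigSub (mem_set Bx)) => //.
have [eI _] := eP i Ai; rewrite /G /=.
by case: (epsP x0 (ex_intro (fun y => F i y /\ e i y = e i x) x (conj Fx erefl))) => Fy; apply: eI.
Qed.

Lemma small_setU (T : Type) (A B : set T) : small A -> small B -> small (A `|` B).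
Proof.
move=> sA sB; rewrite (_ : A `|` B = \bigcup_(b in [set: bool]) if b then A else B).
  by apply: small_bigcup => [|[]]; first exact: small_bool.
apply/seteqP; split => x; first by case=> ?; [exists true|exists false].
by move=> [[] _ ?]; [left|right].
Qed.

Lemma small_seq_in (T : Type) (A : set T) : small A ->
  small [set s : seq T | forall n x, onth s n = Some x -> A x].
Proof.
move=> /small_set_type sA.
have := small_fun small_nat (small_option sA).
have [[x0 _]|noT] := pselect (exists x : T, True); last first.
  move=> _; apply: small_finite; apply: (@sub_finite_set _ _ [set [::]]) => [|].
    by case=> // x; case: noT; exists x.
  exact: finite_set1.
move=> sf; pose G (p : seq T) (n : nat) : option A :=
  if onth p n is Some x then
    (if pselect (A x) is left Ax then Some (SigSub (mem_set Ax)) else None) else None.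
apply: small_le sf _; apply: (@card_le_inj _ _ _ _ G) => // s t sA' tA' st.
have ext n : onth s n = onth t n.
  have := congr1 (fun h => h n) st; rewrite /G.
  have := sA' n; have := tA' n; case: (onth s n) => [x|]; case: (onth t n) => [y|] //.
  - move=> /(_ _ erefl) Ay /(_ _ erefl) Ax; case: pselect => // ?; case: pselect => // ?.
    by case=> ->.
  - by move=> _ /(_ _ erefl) Ax; case: pselect.
  - by move=> /(_ _ erefl) Ay; case: pselect.
elim: s t ext {sA' tA' st} => [|x s IH] [|y t] ext //.
- by have := ext 0.
- by have := ext 0.
- have := ext 0 => /= -[->]; congr cons; apply: IH => n.
  exact: ext n.+1.
Qed.

Lemma small_seq (T : Type) : small [set: T] -> small [set: seq T].
Proof. by move=> /small_seq_in sT; apply: small_sub sT _. Qed.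

Lemma small_sigT (I : Type) (F : I -> Type) : small [set: I] ->
  (forall i, small [set: F i]) -> small [set: {i & F i}].
Proof.
move=> sI sF.
apply: (@small_sub _ _ (\bigcup_(i in [set: I]) range (fun x : F i => existT F i x))).
  by apply: small_bigcup => // i _; exact: small_range.
by move=> [i x] _; exists i => //; exists x.
Qed.

(** The initial ordinal of K: if some initial segment is not small, the least m with this property
    has a segment of the size of K whose own initial segments are all small, and the order is pulled
    back along an injection into that segment. *)
Lemma exists_small_wo (T : Type) : [set: T] #<= [set: K] ->
  exists lt : T -> T -> Prop, well_order_rel lt /\ forall x, small [set y | lt y x].
Proof.
case: K_inhabited => k0 /(card_leT_inj_ex k0) [f fI].
suff [lt [ltwo lts]] : exists lt : K -> K -> Prop,
    well_order_rel lt /\ forall x, small [set y | lt y x].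
  exists (fun x y => lt (f x) (f y)); split; first exact: well_order_rel_inj.
  move=> x; apply: small_le (lts (f x)) _.
  by apply: (@card_le_inj _ _ _ _ f) => // y z _ _ /fI.
have [lt ltwo] := wo_exists K.
have [all|] := pselect (forall x, small [set y | lt y x]); first by exists lt.
move=> /existsNP /(wo_min ltwo) [m [/not_smallP mK mM]].
have [g [gm gI']] := card_le_inj_ex k0 mK.
have gI : injective g by move=> x y; exact: gI'.
exists (fun x y => lt (g x) (g y)); split; first exact: well_order_rel_inj.
move=> x; have /contrapT sgx := mM (g x) (gm x I); apply: small_le sgx _.
by apply: (@card_le_inj _ _ _ _ g) => // y z _ _ /gI.
Qed.

(* Order the lists first by their largest element. *)
Lemma exists_small_wo_seq (T : Type) : [set: T] #<= [set: K] ->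
  exists lt : seq T -> seq T -> Prop,
    well_order_rel lt /\ forall x, small [set y | lt y x].
Proof.
move=> /exists_small_wo [lt [ltwo lts]].
have [lt' lt'wo] := wo_exists (seq T).
pose bd (s : seq T) := [set x | exists2 y, (exists n, onth s n = Some y) & x = y \/ lt x y].
pose r (s t : seq T) := bd s `<=` bd t.
have bdlow s x y : bd s x -> lt y x -> bd s y.
  move=> [z zs [->|xz]] yx; exists z => //; right => //.
  exact: (wo_trans ltwo) yx xz.
have rtot s t : r s t \/ r t s.
  apply: contrapT => /not_orP [] /existsNP [x /not_implyP [sx ntx]].
  move=> /existsNP [y /not_implyP [ty nsy]].
  have [xy|xy|yx] := wo_total ltwo x y.
  - by apply: ntx; exact: bdlow xy.
  - by apply: ntx; rewrite xy.
  - by apply: nsy; exact: bdlow yx.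
exists (fun s t => (r s t /\ ~ r t s) \/ (bd s = bd t /\ lt' s t)); split.
  apply: wo_of_min.
  - by move=> s [[]//|[_ /(wo_irr lt'wo)]].
  - move=> s t u [[st nts]|[st st']] [[tu nut]|[tu tu']].
    + left; split; first exact: subset_trans tu.
      by move=> us; apply: nts; exact: subset_trans us.
    + by left; rewrite /r -tu; split.
    + by left; rewrite /r st; split.
    + right; split; first by rewrite st.
      exact: (wo_trans lt'wo) st' tu'.
  - move=> s t.
    have [st|nst] := pselect (r s t); have [ts|nts] := pselect (r t s).
    + have e : bd s = bd t by apply/seteqP; split.
      case: (wo_total lt'wo s t) => h.
      * by constructor 1; right.
      * by constructor 2.
      * by constructor 3; right.
    + by constructor 1; left.
    + by constructor 3; left.
    + by case: (rtot s t).
  - move=> P [s0 Ps0].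
    suff [s [Ps sM]] : exists s, P s /\ forall t, P t -> r s t.
      have [u [[Pu us] uM]] := wo_min lt'wo (ex_intro (fun u => P u /\ bd u = bd s) s (conj Ps erefl)).
      exists u; split => // t [[tu nut]|[tu tu']] Pt.
        by apply: nut; rewrite /r us; exact: sM.
      by apply: (uM t tu'); split => //; rewrite tu us.
    have [[x0 [t0 Pt0 nt0]]|noQ] := pselect (exists x, exists2 t, P t & ~ bd t x); last first.
      by exists s0; split => // t Pt x _; apply: contrapT => ntx; apply: noQ; exists x, t.
    have [x [[t Pt ntx] xM]] := wo_min ltwo (ex_intro (fun x => exists2 t, P t & ~ bd t x) x0 (ex_intro2 _ _ t0 Pt0 nt0)).
    exists t; split => // t' Pt' y ty.
    have [yx|yx|xy] := wo_total ltwo y x; last first.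
    + by case: ntx; exact: bdlow xy.
    + by case: ntx; rewrite -yx.
    + by apply: contrapT => nty; apply: (xM y yx); exists t'.
(* [bd s] is the downward closure of the entries of s. Every predecessor of s is a finite sequence
   of elements of [bd s], and there are few of these. *)
move=> s; have sbd : small (bd s).
  pose A := [set y | exists n, onth s n = Some y].
  rewrite (_ : bd s = \bigcup_(y in A) ([set y] `|` [set x | lt x y])).
    apply: small_bigcup => [|y _]; last first.
      by apply: small_setU => //; exact/small_finite/finite_set1.
    apply: small_finite; rewrite /A; elim: s {A} => [|y s IH].
      by apply: sub_finite_set (finite_set0 T) => x [n]; rewrite onth0n.
    rewrite (_ : [set _ | _] = [set y] `|` [set x | exists n, onth s n = Some x]).
      by rewrite finite_setU; split => //; exact: finite_set1.
    apply/seteqP; split => x /= => [[[|n]] /=|[->|[n nx]]].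
    - by case=> ->; left.
    - by right; exists n.
    - by exists 0.
    - by exists n.+1.
  apply/seteqP; split => [x [y ys [->|xy]]|x [y ys [->|xy]]];
    by [exists y => //; left|exists y => //; right].
apply: small_sub (small_seq_in sbd) _ => t /= ts n x tnx.
have tx : bd t x by exists x; [exists n|left].
by case: ts => [[ts _]|[<- _]] //; exact: ts.
Qed.

End Small.

(** * Homogeneous sequences *)

Lemma infinite_inj (T : Type) (A : set T) : infinite_set A ->
  exists f : nat -> T, injective f /\ forall n, A (f n).
Proof.
move=> /[dup] /infinite_setN0 [x0 _] /infiniteP /(card_le_inj_ex x0) [f [fA fI]].
by exists f; split => [i j /fI|n]; [apply|exact: fA].
Qed.

(* End-homogeneous sequences: the sequence of s continues with a point t that
   has the same colour as s with all earlier points, chosen independently of s. *)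
Lemma erdos_rado (S J Col : Type) (lt : J -> J -> Prop) (c : S -> S -> Col) :
  well_order_rel lt -> ~ ([set: S] #<= [set: (J -> Col) * J]) ->
  ~ ([set: J] #<= [set: Col * nat]) ->
  exists (s : nat -> S) (k : Col), injective s /\
    forall i j, i <> j -> c (s i) (s j) = k \/ c (s j) (s i) = k.
Proof.
move=> jwo nS nJ.
have [s0 _] : exists s : S, True.
  apply: contrapT => no; apply: nS; rewrite (_ : [set: S] = set0) //.
  by apply/seteqP; split => // s _; apply: no; exists s.
pose P (s : S) (j : J) (g : forall i, lt i j -> S) : set S :=
  [set t | forall i (ij : lt i j), g i ij <> t /\ c (g i ij) t = c (g i ij) s].
pose f s := Fix (wo_wf jwo) (fun _ => S) (fun j g => eps s0 (P s j g)).
pose Q s j := [set t | forall i, lt i j -> f s i <> t /\ c (f s i) t = c (f s i) s].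
have fE s j : f s j = eps s0 (Q s j).
  rewrite /f Fix_eq // => {}j g h gh; congr eps; apply/seteqP; split => t tP i ij.
    by rewrite -gh.
  by rewrite gh.
(* If every s occurs in its own sequence, s is determined by its position [h s] and its colours with
   the earlier terms, which injects S into a type that was assumed not to be that large. *)
have [[s sN]|hit] := pselect (exists s, forall j, f s j <> s); last first.
  exfalso; apply: nS.
  have /choice [h hP] s : exists j, f s j = s.
    by apply: contrapT => no; apply: hit; exists s => j e; apply: no; exists j.
  pose e s : (J -> Col) * J := (fun i => if pselect (lt i (h s)) then c (f s i) s else c s0 s0, h s).
  apply: (@card_leT_inj _ _ e) => s t [est hst].
  have ff : forall j, lt j (h s) \/ j = h s -> f s j = f t j.
    apply: (well_founded_ind (wo_wf jwo)) => j IH jh.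
    have ijh i : lt i j -> lt i (h s).
      by move=> ij; case: jh => [jh|<-//]; exact: (wo_trans jwo) ij jh.
    rewrite !fE; congr eps; apply/seteqP; split => u uP i ij.
      have [iu cu] := uP i ij; rewrite -(IH i ij); last by left; exact: ijh.
      split => //; rewrite cu; have := congr1 (fun g => g i) est => /=.
      rewrite -hst; case: pselect => [a|nh] /=; last by case: (nh (ijh _ ij)).
      move=> ->.
      by rewrite -(IH i ij); last by left; exact: ijh.
    have [iu cu] := uP i ij; rewrite (IH i ij); last by left; exact: ijh.
    split => //; rewrite cu; have := congr1 (fun g => g i) est => /=.
    rewrite -hst; case: pselect => [a|nh] /=; last by case: (nh (ijh _ ij)).
    move=> <-.
    by rewrite (IH i ij); last by left; exact: ijh.
  by rewrite -(hP s) (ff (h s)); [rewrite hst hP|right].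
have fP j : Q s j (f s j).
  elim/(well_founded_ind (wo_wf jwo)): j => j IH; rewrite fE.
  by apply: epsP; exists s => i ij; split => //; exact: sN.
have fI : injective (f s).
  move=> i j ij; case: (wo_total jwo i j) => // h.
    by have [/(_ ij)] := fP _ _ h.
  by have [/(_ (esym ij))] := fP _ _ h.
pose col j := c (f s j) s.
(* For i below j the colour of the i-th with the j-th term is [col i], so it remains to find a value
   that [col] takes infinitely often. *)
have [[k kinf]|fin] := pselect (exists k, infinite_set [set j | col j = k]).
  have [u [uI uk]] := infinite_inj kinf.
  exists (f s \o u), k; split => [i j /fI /uI //|i j ij /=].
  case: (wo_total jwo (u i) (u j)) => [h|/uI//|h].
    by left; have [_ ->] := fP _ _ h; exact: uk.
  by right; have [_ ->] := fP _ _ h; exact: uk.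
exfalso; apply: nJ.
have /choice [e eI] k : exists e : J -> nat, forall i j, col i = k -> col j = k -> e i = e j -> i = j.
  have : finite_set [set j | col j = k] by apply: contrapT => kinf; apply: fin; exists k.
  by move=> /finite_set_countable /(card_le_inj_ex 0) [e [_ eI]]; exists e.
apply: (@card_leT_inj _ _ (fun j => (col j, e (col j) j))) => i j [ij].
by rewrite ij; apply: eI.
Qed.

(** Cantor's theorem twice: J is a power set above the colours and S one above the end-homogeneous
    codes. S depends on the colours alone, so it is available before any colouring is. The
    enumeration of the homogeneous set ignores the order of J, hence the two orientations in the
    conclusion. *)
Lemma exists_homogeneous_type (K : Type) (K_inacc : strongly_inaccessible K)
    (Col : Type) : small K [set: Col] ->
  exists S : Type, small K [set: S] /\ forall c : S -> S -> Col,
    exists (s : nat -> S) (k : Col), injective s /\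
      forall i j, i <> j -> c (s i) (s j) = k \/ c (s j) (s i) = k.
Proof.
move=> sCol; pose J := set (Col * nat); pose S := set ((J -> Col) * J).
have sJ : small K [set: J].
  exact/(small_powerset K_inacc)/(small_prod K_inacc)/small_nat.
exists S; split => [|c].
  by apply/(small_powerset K_inacc)/(small_prod K_inacc) => //; exact: small_fun.
have [lt jwo] := wo_exists J.
by apply: erdos_rado jwo _ _; exact: not_card_le_powerset.
Qed.

(** * Counting solutions *)

(** Finiteness is not first-order, but having fewer than k elements is. Whatever finiteness has to
    pass to another tuple or structure therefore goes through a bound k. *)
Definition atleast (T : Type) (k : nat) (X : set T) : Prop :=
  exists f : 'I_k -> T, injective f /\ forall i, X (f i).

Lemma vcons0 (X : Type) n (a : X) (v : 'I_n -> X) : vcons a v ord0 = a.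
Proof. by rewrite /vcons unlift_none. Qed.

Lemma vconsS (X : Type) n (a : X) (v : 'I_n -> X) i : vcons a v (lift ord0 i) = v i.
Proof. by rewrite /vcons liftK. Qed.

Lemma atleastS (T : Type) k (X : set T) :
  atleast k.+1 X <-> exists x, X x /\ atleast k (X `\ x).
Proof.
split=> [[f [fI fX]]|[x [Xx [f [fI fX]]]]].
  exists (f ord0); split => //; exists (f \o lift ord0); split.
    by move=> i j /fI /lift_inj.
  by move=> i; split; [exact: fX|move=> /fI /eqP; rewrite eq_sym (negbTE (neq_lift _ _))].
exists (vcons x f); split => [i j|i].
  case: (unliftP ord0 i) => [i' ->|->]; case: (unliftP ord0 j) => [j' ->|->];
    rewrite ?vcons0 ?vconsS //.
  - by move=> /fI ->.
  - by move=> e; case: (fX i') => _ /(_ e).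
  - by move=> e; case: (fX j') => _ /(_ (esym e)).
by case: (unliftP ord0 i) => [i' ->|->]; rewrite ?vcons0 ?vconsS //; case: (fX i').
Qed.

Lemma atleast_sub (T : Type) k (X Y : set T) : X `<=` Y -> atleast k X -> atleast k Y.
Proof. by move=> XY [f [fI fX]]; exists f; split => // i; exact/XY/fX. Qed.

Lemma infinite_atleast (T : Type) (X : set T) :
  infinite_set X <-> forall k, atleast k X.
Proof.
split=> [/infinite_inj [f [fI fX]] k|all fin].
  by exists (fun i : 'I_k => f i); split => // i j /fI /val_inj.
case: fin => n Xn; have [f [fI fX]] := all n.+1.
suff : `I_n.+1 #<= `I_n by rewrite card_le_II ltnn.
have XIn : X #<= `I_n by exact: card_eq_leW.
apply: card_le_trans XIn; apply: (@card_le_trans _ _ _ [set: 'I_n.+1]).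
  by apply: card_eq_leW; exact: card_II.
by apply: (@card_le_inj _ _ _ _ f) => [i _|i j _ _ /fI]; first exact: fX.
Qed.

Lemma finite_atleast (T : Type) (X : set T) :
  finite_set X <-> exists k, ~ atleast k X.
Proof.
split=> [fX|[k nk]]; last by apply: contrapT => /infinite_atleast /(_ k).
by apply: contrapT => /forallNP no; move: fX; apply/infinite_atleast => k; exact: contrapT (no k).
Qed.

(** * Definability *)

(** Variables are named by arbitrary types. [None] is the variable that is quantified or solved for,
    [Some] holds the parameters, and substitution is composition. *)
Definition ext (X V : Type) (a : X) (v : V -> X) (o : option V) : X := oapp v a o.

Section Definability.
Context (L : language).

Fixpoint ren_term n m (f : 'I_n -> 'I_m) (t : term L n) : term L m :=
  match t with
  | Var i => Var (f i)
  | App g ts => App g (fun i => ren_term f (ts i))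
  end.

Definition lift_ren n m (f : 'I_n -> 'I_m) : 'I_n.+1 -> 'I_m.+1 :=
  vcons ord0 (lift ord0 \o f).

Fixpoint ren n (phi : formula L n) : forall m, ('I_n -> 'I_m) -> formula L m :=
  match phi in formula _ n return forall m, ('I_n -> 'I_m) -> formula L m with
  | Falsum _ => fun m f => Falsum
  | Equal _ s t => fun m f => Equal (ren_term f s) (ren_term f t)
  | Rel _ r ts => fun m f => Rel r (fun i => ren_term f (ts i))
  | Imp _ p q => fun m f => Imp (ren p f) (ren q f)
  | All _ p => fun m f => All (ren p (lift_ren f))
  end.

Lemma eval_ren (M : structure L) n m (f : 'I_n -> 'I_m) (v : 'I_m -> M) (t : term L n) :
  eval v (ren_term f t) = eval (v \o f) t.
Proof.
elim: t => [//|g ts IH] /=; congr fun_interp; apply/funext => i; exact: IH.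
Qed.

Lemma vcons_lift_ren (X : Type) n m (f : 'I_n -> 'I_m) (a : X) (v : 'I_m -> X) :
  vcons a v \o lift_ren f = vcons a (v \o f).
Proof.
apply/funext => i /=; rewrite /lift_ren.
by case: (unliftP ord0 i) => [j ->|->]; rewrite ?vconsS ?vcons0 //= vconsS.
Qed.

Lemma sat_ren (M : structure L) n (phi : formula L n) m (f : 'I_n -> 'I_m) (v : 'I_m -> M) :
  sat (ren phi f) v <-> sat phi (v \o f).
Proof.
elim: phi m f v => {n} [n|n s t|n r ts|n p IHp q IHq|n p IHp] m f v /=.
- by [].
- by rewrite !eval_ren.
- rewrite (_ : (fun i => eval v (ren_term f (ts i))) = fun i => eval (v \o f) (ts i)) //.
  by apply/funext => i; exact: eval_ren.
- by split=> pq /IHp /pq /IHq.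
- split=> all a; first by have /IHp := all a; rewrite vcons_lift_ren.
  by apply/IHp; rewrite vcons_lift_ren; exact: all.
Qed.

(** Definability as a semantic property, uniform in the structure: closure under connectives,
    quantifiers and counting replaces the handling of syntax, and uniformity lets definitions pass
    between structures. *)
Definition defn (V : Type) (P : forall N : structure L, (V -> N) -> Prop) : Prop :=
  exists n (phi : formula L n) (g : 'I_n -> V),
    forall N v, P N v <-> sat phi (v \o g).

Definition tpeq (V : Type) (N1 N2 : structure L) (v : V -> N1) (w : V -> N2) : Prop :=
  forall n (phi : formula L n) (g : 'I_n -> V), sat phi (v \o g) <-> sat phi (w \o g).

Lemma tpeq_defn V (N1 N2 : structure L) (v : V -> N1) (w : V -> N2)
    (P : forall N : structure L, (V -> N) -> Prop) :
  tpeq v w -> defn P -> P N1 v <-> P N2 w.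
Proof. by move=> vw [n [phi [g Pg]]]; rewrite !Pg; exact: vw. Qed.

Lemma tpeqP V (N1 N2 : structure L) (v : V -> N1) (w : V -> N2) :
  (forall n (phi : formula L n) (g : 'I_n -> V), sat phi (v \o g) -> sat phi (w \o g)) ->
  tpeq v w.
Proof.
move=> vw n phi g; split; first exact: vw.
by move=> sw; apply: contrapT => /(vw _ (Neg phi) g) /(_ sw).
Qed.

Lemma tpeq_sym V (N1 N2 : structure L) (v : V -> N1) (w : V -> N2) :
  tpeq v w -> tpeq w v.
Proof. by move=> vw n phi g; rewrite vw. Qed.

Lemma tpeq_trans V (N1 N2 N3 : structure L) (v : V -> N1) (w : V -> N2) (u : V -> N3) :
  tpeq v w -> tpeq w u -> tpeq v u.
Proof. by move=> vw wu n phi g; rewrite vw. Qed.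

Lemma tpeq_comp V W (h : W -> V) (N1 N2 : structure L) (v : V -> N1) (w : V -> N2) :
  tpeq v w -> tpeq (v \o h) (w \o h).
Proof. by move=> vw n phi g; exact: (vw n phi (h \o g)). Qed.

Lemma defn_iff V (P Q : forall N : structure L, (V -> N) -> Prop) :
  (forall N v, P N v <-> Q N v) -> defn P -> defn Q.
Proof.
by move=> PQ [n [phi [g Pg]]]; exists n, phi, g => N v; rewrite -PQ.
Qed.

Lemma defn_sat V n (phi : formula L n) (g : 'I_n -> V) :
  defn (fun N v => sat phi (v \o g)).
Proof. by exists n, phi, g. Qed.

Lemma defn_comp V W (h : W -> V) (P : forall N : structure L, (W -> N) -> Prop) :
  defn P -> defn (fun N (v : V -> N) => P N (v \o h)).
Proof. by move=> [n [phi [g Pg]]]; exists n, phi, (h \o g) => N v; rewrite Pg. Qed.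

Lemma defn_False V : defn (fun N (v : V -> N) => False).
Proof. by exists 0, Falsum, (@vnil V). Qed.

Lemma defn_eq V (x y : V) : defn (fun N (v : V -> N) => v x = v y).
Proof.
exists 2, (Equal (Var ord0) (Var ord_max)), (fun i => if i == ord0 then x else y).
by [].
Qed.

Lemma vcat_lshift (X : Type) n m (v : 'I_n -> X) (w : 'I_m -> X) i :
  vcat v w (lshift m i) = v i.
Proof. by rewrite /vcat; have /= -> := unsplitK (inl i : 'I_n + 'I_m). Qed.

Lemma vcat_rshift (X : Type) n m (v : 'I_n -> X) (w : 'I_m -> X) i :
  vcat v w (rshift n i) = w i.
Proof. by rewrite /vcat; have /= -> := unsplitK (inr i : 'I_n + 'I_m). Qed.

Lemma comp_vcat (X Y : Type) (h : X -> Y) n m (v : 'I_n -> X) (w : 'I_m -> X) :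
  h \o vcat v w = vcat (h \o v) (h \o w).
Proof. by apply/funext => i; rewrite /vcat /=; case: (fintype.split i). Qed.

Lemma defn_imp V (P Q : forall N : structure L, (V -> N) -> Prop) :
  defn P -> defn Q -> defn (fun N v => P N v -> Q N v).
Proof.
move=> [n [phi [g Pg]]] [m [psi [h Qh]]].
exists (n + m)%N, (Imp (ren phi (@lshift n m)) (ren psi (@rshift n m))), (vcat g h) => N v /=.
rewrite Pg Qh !sat_ren (_ : _ \o _ \o @lshift n m = v \o g) //.
  rewrite (_ : _ \o _ \o @rshift n m = v \o h) //.
  by apply/funext => i /=; rewrite vcat_rshift.
by apply/funext => i /=; rewrite vcat_lshift.
Qed.

Lemma defn_not V (P : forall N : structure L, (V -> N) -> Prop) :
  defn P -> defn (fun N v => ~ P N v).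
Proof. by move=> dP; apply: defn_imp => //; exact: defn_False. Qed.

Lemma defn_and V (P Q : forall N : structure L, (V -> N) -> Prop) :
  defn P -> defn Q -> defn (fun N v => P N v /\ Q N v).
Proof.
move=> dP dQ; apply: (@defn_iff _ (fun N v => ~ (P N v -> ~ Q N v))).
  by move=> N v; rewrite not_implyE notK.
by apply: defn_not; apply: defn_imp => //; exact: defn_not.
Qed.

Lemma defn_True V : defn (fun N (v : V -> N) => True).
Proof.
apply: (@defn_iff _ (fun N v => ~ False)); first by move=> N v; split => // _ [].

exact/defn_not/defn_False.
Qed.

(* A code whose variables may be [None] is rewritten so that exactly its
   variable [ord0] is interpreted by [None]. *)
Lemma sat_option V n (phi : formula L n) (g : 'I_n -> option V) :
  exists m (psi : formula L m.+1) (h : 'I_m -> V), forall (N : structure L) (a : N) v,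
    sat phi (ext a v \o g) <-> sat psi (vcons a (v \o h)).
Proof.
have [[v0 _]|noV] := pselect (exists v : V, True); last first.
  exists 0, (ren phi (fun=> ord0)), (@vnil V) => N a v; rewrite sat_ren.
  rewrite (_ : ext a v \o g = vcons a (v \o @vnil V) \o (fun=> ord0)) //.
  apply/funext => i /=; rewrite vcons0; case: (g i) => // x.
  by case: noV; exists x.
pose r i := if g i is Some _ then lift ord0 i else ord0.
exists n, (ren phi r), (odflt v0 \o g) => N a v; rewrite sat_ren.
rewrite (_ : ext a v \o g = vcons a (v \o (odflt v0 \o g)) \o r) //.
by apply/funext => i /=; rewrite /r; case e: (g i) => [x|]; rewrite ?vcons0 ?vconsS //= e.
Qed.

Lemma defn_all V (P : forall N : structure L, (option V -> N) -> Prop) :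
  defn P -> defn (fun N v => forall a, P N (ext a v)).
Proof.
move=> [n [phi [g Pg]]]; have [m [psi [h psih]]] := sat_option phi g.
exists m, (All psi), h => N v /=; split=> all a; first by apply/psih/Pg.
by apply/Pg/psih.
Qed.

Lemma defn_ex V (P : forall N : structure L, (option V -> N) -> Prop) :
  defn P -> defn (fun N v => exists a, P N (ext a v)).
Proof.
move=> dP; apply: (@defn_iff _ (fun N v => ~ forall a, ~ P N (ext a v))).
  by move=> N v; split=> [/existsNP [a /contrapT]|[a Pa] /(_ a)//]; exists a.
by apply: defn_not; apply: (@defn_all _ (fun N v => ~ P N v)); exact: defn_not.
Qed.

Lemma defn_atleast V k (P : forall N : structure L, (option V -> N) -> Prop) :
  defn P -> defn (fun N v => atleast k [set a | P N (ext a v)]).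
Proof.
elim: k V P => [|k IH] V P dP.
  apply: defn_iff (@defn_True V) => N v; split => // _.
  by exists (@vnil N); split => [[]|[]].
pose h (o : option V) : option (option V) := if o is Some x then Some (Some x) else None.
(* [Some None] names the solution already found and [None] the further ones. *)
pose Q (N : structure L) (w : option (option V) -> N) :=
  P N (w \o h) /\ ~ (w None = w (Some None)).
have dQ : defn Q.
  apply: defn_and; first exact: (defn_comp h dP).
  exact/defn_not/defn_eq.
apply: defn_iff (defn_ex (defn_and dP (IH _ _ dQ))) => N v.
rewrite atleastS; split=> [] [x [Px al]]; exists x; split => //;
  apply: atleast_sub al => a /=; rewrite /Q /=;
  (have -> : ext a (ext x v) \o h = ext a v by apply/funext => -[]) => //.
Qed.

(** * Definable sets and algebraic closure *)

Section Sets.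
Context (M : structure L).

Definition pdef (A X : set M) : Prop :=
  exists phi : pformula M 1, Defs.over A phi /\ forall a, X a <-> psat phi (fun=> a).

Lemma pdef_defn V (P : forall N : structure L, (option V -> N) -> Prop) (A : set M) (v : V -> M) :
  defn P -> (forall i, A (v i)) -> pdef A [set a | P M (ext a v)].
Proof.
move=> [n [phi [g Pg]]] Av; have [m [psi [h psih]]] := sat_option phi g.
exists (@PFormula L M 1 m psi (v \o h)); split => [i|a]; first exact: Av.
rewrite /= Pg psih /psat /= (_ : vcons a (v \o h) = @vcat M 1 m (fun=> a) (v \o h)) //.
apply/funext => i; case: (unliftP ord0 i) => [j ->|->].
  by rewrite vconsS (_ : lift ord0 j = rshift 1 j) ?vcat_rshift //; exact: val_inj.
by rewrite vcons0 (_ : ord0 = lshift m (ord0 : 'I_1)) ?vcat_lshift //; exact: val_inj.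
Qed.

Lemma psat1E (phi : pformula M 1) a :
  psat phi (fun=> a) <->
  sat (pbody phi) (ext a (pparam phi) \o vcat (fun=> None) Some).
Proof. by rewrite /psat comp_vcat. Qed.

Lemma pdefP (A X : set M) : pdef A X <->
  exists P : forall N : structure L, (option A -> N) -> Prop,
    defn P /\ forall a, X a <-> P M (ext a val).
Proof.
split=> [[phi [phiA Xphi]]|[P [dP XP]]]; last first.
  rewrite (_ : X = [set a | P M (ext a val)]); last by apply/seteqP; split => a /XP.
  by apply: pdef_defn => // i; exact/set_mem/valP.
pose w i : A := SigSub (mem_set (phiA i)).
exists (fun N v => sat (pbody phi) (v \o omap w \o vcat (fun=> None) Some)); split.
  exact: (defn_sat (pbody phi) (omap w \o vcat (fun=> None) Some)).
move=> a; rewrite Xphi psat1E (_ : ext a _ \o omap w = ext a (pparam phi)) //.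
by apply/funext => -[].
Qed.

Lemma pdef_iff (A X Y : set M) : (forall a, X a <-> Y a) -> pdef A X -> pdef A Y.
Proof. by move=> XY [phi [phiA Xphi]]; exists phi; split => // a; rewrite -XY. Qed.

Lemma pdef_sub (A B X : set M) : A `<=` B -> pdef A X -> pdef B X.
Proof. by move=> AB [phi [phiA Xphi]]; exists phi; split => // i; exact/AB/phiA. Qed.

Lemma pdefC (A X : set M) : pdef A X -> pdef A (~` X).
Proof.
move=> /pdefP [P [dP XP]]; apply/pdefP; exists (fun N v => ~ P N v).
by split; [exact: defn_not|move=> a; rewrite /setC /= XP].
Qed.

Lemma pdefI (A X Y : set M) : pdef A X -> pdef A Y -> pdef A (X `&` Y).
Proof.
move=> /pdefP [P [dP XP]] /pdefP [Q [dQ YQ]]; apply/pdefP.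
exists (fun N v => P N v /\ Q N v).
by split; [exact: defn_and|move=> a; rewrite /setI /= XP YQ].
Qed.

Lemma pdefT (A : set M) : pdef A setT.
Proof.
by apply/pdefP; exists (fun N v => True); split => //; exact: defn_True.
Qed.

Lemma pdef1 (A : set M) b : A b -> pdef A [set b].
Proof.
move=> Ab; apply/pdefP; exists (fun N v => v None = v (Some (SigSub (mem_set Ab)))).
by split => //; exact: defn_eq.
Qed.

Lemma pdef_params (A X : set M) : pdef A X ->
  exists B : set M, [/\ finite_set B, B `<=` A & pdef B X].
Proof.
move=> [phi [phiA Xphi]]; exists (range (pparam phi)); split.
- exact/finite_image/finite_finset.
- by move=> _ [i _ <-]; exact: phiA.
- by exists phi; split => // i; exists i.
Qed.

Lemma algebraicP (phi : pformula M 1) :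
  algebraic phi <-> finite_set [set a | psat phi (fun=> a)].
Proof.
split=> fin.
  apply: sub_finite_set (finite_image (fun x : 'I_1 -> M => x ord0) fin) => a pa.
  by exists (fun=> a).
apply: sub_finite_set (finite_image (fun a => (fun=> a) : 'I_1 -> M) fin) => x px.
have xE : x = fun=> x ord0 by apply/funext => i; rewrite ord1.
by exists (x ord0) => //=; rewrite -xE.
Qed.

Lemma aclP (A : set M) a : acl A a <->
  exists X, [/\ pdef A X, finite_set X & X a].
Proof.
split=> [[phi [phiA /algebraicP fin pa]]|[X [[phi [phiA Xphi]] fin Xa]]].
  by exists [set b | psat phi (fun=> b)]; split => //; exists phi.
exists phi; split => //; last exact/Xphi.
by apply/algebraicP; rewrite (_ : [set b | _] = X) //; apply/seteqP; split => b /Xphi.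
Qed.

Lemma acl_sub (A B : set M) : A `<=` B -> acl A `<=` acl B.
Proof.
move=> AB a /aclP [X [dX fX Xa]]; apply/aclP; exists X; split => //.
exact: pdef_sub dX.
Qed.

Lemma acl_refl (A : set M) : A `<=` acl A.
Proof.
move=> a Aa; by apply/aclP; exists [set a]; split => //; exact: pdef1.
Qed.

Lemma acl_finite (A : set M) a : acl A a ->
  exists B : set M, [/\ finite_set B, B `<=` A & acl B a].
Proof.
move=> /aclP [X [dX fX Xa]]; have [B [fB BA dB]] := pdef_params dX.
by exists B; split => //; apply/aclP; exists X.
Qed.

Lemma acl_trans1 (A : set M) a b : acl (A `|` [set b]) a -> acl A b -> acl A a.
Proof.
move=> /aclP [X [/pdefP [P [dP XP]] /finite_atleast [k nk] Xa]].
move=> /aclP [Y [/pdefP [Q [dQ YQ]] fY Yb]].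
(* The solutions of X_y for those y in Y for which X_y has fewer than k elements. *)
pose g (x : A `|` [set b]) : option A :=
  if pselect (A (val x)) is left Ax then Some (SigSub (mem_set Ax)) else None.
pose R (N : structure L) (w : option (option A) -> N) := P N (w \o omap g).
have dR : defn R by exact: (defn_comp (omap g) dP).
have RE y c : y = b -> R M (ext c (ext y val)) <-> X c.
  move=> ->; rewrite /R XP (_ : _ \o omap g = ext c val) //.
  apply/funext => -[x|] //=; rewrite /g; case: pselect => //= nAx.
  by have /set_mem [/nAx|/= ->] := valP x.
pose E (N : structure L) (w : option (option A) -> N) :=
  Q N (w \o Some) /\ (~ atleast k [set c | R N (ext c (w \o Some))] /\ R N w).
pose h (o : option A) : option (option A) :=
  if o is Some x then Some (Some x) else None.
pose sw (o : option (option A)) : option (option A) :=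
  match o with Some (Some x) => Some (Some x) | Some None => None | None => Some None end.
have dE : defn E.
  apply: defn_and; first exact: (defn_comp Some dQ).
  apply: defn_and => //.
  exact: (defn_comp Some (defn_not (defn_atleast k dR))).
pose Z := [set c | exists y, E M (ext y (ext c val) \o sw)].
apply/aclP; exists Z; split.
- apply/pdefP; exists (fun N v => exists y, E N (ext y v \o sw)); split => //.
  exact: defn_ex (defn_comp sw dE).
- apply: (@sub_finite_set _ _ (\bigcup_(y in Y `&` [set y | ~ atleast k [set c | R M (ext c (ext y val))]])
      [set c | R M (ext c (ext y val))])).
    have swE c y : ext y (ext c val) \o sw = ext c (ext y val) :> (option (option A) -> M).
      by apply/funext => -[[]|].
    by move=> c [y]; rewrite swE => -[/YQ Yy [nl Rc]]; exists y.
  apply: bigcup_finite; first exact: finite_setIl.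
  by move=> y [_ nl]; apply/finite_atleast; exists k.
- exists b; rewrite (_ : _ \o sw = ext a (ext b val)); last by apply/funext => -[[]|].
  split; first exact/YQ.
  split; last exact/RE.
  rewrite (_ : [set c | _] = X) //; apply/seteqP; split => c /=; first by move/RE; apply.
  by move=> Xc; apply/RE.
Qed.

End Sets.

(** The formula that witnesses algebraicity is strengthened by the clause that it has fewer than k
    solutions, and so transfers. *)
Lemma acl_tpeq V (N1 N2 : structure L) (v : V -> N1) (w : V -> N2) a b :
  tpeq (ext a v) (ext b w) -> acl (range v) a -> acl (range w) b.
Proof.
move=> vw /aclP [X [/pdefP [P [dP XP]] /finite_atleast [k nk] Xa]].
have /choice [g gP] : forall x : range v, exists i, v i = val x.
  by move=> x; have /set_mem [i _ e] := valP x; exists i.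
pose Q (N : structure L) (u : option V -> N) := P N (u \o omap g).
have dQ : defn Q by exact: (defn_comp (omap g) dP).
have QX c : Q N1 (ext c v) <-> X c.
  rewrite /Q XP (_ : _ \o omap g = ext c val) //.
  by apply/funext => -[x|] //=; exact: gP.
have := tpeq_defn vw (defn_and dQ (defn_comp Some (defn_not (defn_atleast k dQ)))).
move=> [+ _] => /(_ _) [].
  split; first exact/QX.
  by rewrite (_ : [set c | _] = X) //; apply/seteqP; split => c /QX.
move=> Qb nk'; apply/aclP; exists [set c | Q N2 (ext c w)]; split => //.
  by apply: pdef_defn => // i; exists i.
by apply/finite_atleast; exists k.
Qed.

End Definability.

(** * Saturation *)

Lemma filter_finite_bigcap (T I : Type) (F : set_system T) (E : set I) (Y : I -> set T) :
  Filter F -> finite_set E -> (forall i, E i -> F (Y i)) -> F (\bigcap_(i in E) Y i).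
Proof.
move=> FF fE; have [s sE] : exists s : seq {classic I}, E = [set` s] by apply/finite_seqP.
rewrite sE {fE sE}; elim: s => [|i s IH] FY.
  by rewrite (_ : \bigcap_(i in _) _ = setT) ?set_nil ?bigcap_set0 //; exact: filterT.
have FS : F (Y i `&` \bigcap_(j in [set` s]) Y j).
  apply: filterI; first by apply: FY; rewrite /= in_cons eqxx.
  by apply: IH => j js; apply: FY; rewrite /= in_cons; apply/orP; right.
apply: filterS FS => t [Yi Ys] j /=.
by rewrite in_cons => /orP [/eqP ->|js]; [exact: Yi|exact: Ys].
Qed.

(** Filters stand for partial types, properness for consistency, and having only infinite members
    for non-algebraicity. Adjoining all cofinite sets before extending preserves the latter. *)
Lemma nonprincipal_ultrafilter (T : Type) (F : set_system T) :
  Filter F -> (forall X, F X -> infinite_set X) ->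
  exists U, [/\ UltraFilter U, F `<=` U & forall X, U X -> infinite_set X].
Proof.
move=> FF Finf.
pose G := filter_from [set p : set T * set T | F p.1 /\ finite_set p.2] (fun p => p.1 `\` p.2).
have GF : ProperFilter G.
  apply: filter_from_proper; last first.
    move=> [X Y] [/= FX fY]; apply: infinite_setN0 => fXY; apply: (Finf X FX).
    apply: (@sub_finite_set _ _ ((X `\` Y) `|` Y)); last by rewrite finite_setU.
    by move=> x Xx; have [?|?] := pselect (Y x); [right|left].
  apply: filter_from_filter; first by exists (setT, set0); split => //; exact: filterT.
  move=> [X Y] [X' Y'] [/= FX fY] [/= FX' fY']; exists (X `&` X', Y `|` Y').
    by split; [exact: filterI|rewrite finite_setU].
  by move=> x [/= [Xx Xx'] /not_orP [nY nY']].
have [U [Uultra GU]] := ultraFilterLemma GF.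
have UF : ProperFilter U by exact: ultra_proper.
exists U; split => // [X FX|X UX fX]; first by apply: GU; exists (X, set0) => //= x [].
have : U (X `&` ~` X).
  apply: filterI => //; apply: GU; exists (setT, X); last by move=> x [].
  by split => //; exact: filterT.
by rewrite setICr; exact: filter_not_empty.
Qed.

Lemma finite_set_range (T : Type) (A : set T) : finite_set A ->
  exists n (u : 'I_n -> T), A = range u.
Proof.
move=> fA; have [s sE] : exists s : seq {classic T}, A = [set` s] by apply/finite_seqP.
exists (size s), (tnth (in_tuple s)); rewrite sE; apply/seteqP; split => [x /= xs|_ [i _ <-]].
  by have /tnthP [i ->] : x \in in_tuple s by []; exists i.
exact: mem_tnth.
Qed.

Lemma range_ext (T V : Type) (a : T) (v : V -> T) : range (ext a v) = range v `|` [set a].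
Proof.
apply/seteqP; split => [_ [[x|] _ <-]|_ [[x _ <-]|->]] /=.
- by left; exists x.
- by right.
- by exists (Some x).
- by exists None.
Qed.

Section Over.
Context (L : language) (M : structure L).

Definition type_of (A : set M) (a : M) : set (pformula M 1) :=
  [set phi | Defs.over A phi /\ psat phi (fun=> a)].

Lemma complete_type_of (A : set M) a : complete_type A (type_of A a).
Proof.
split=> [phi []//|F Fp _|phi phiA].
  by exists (fun=> a) => phi /Fp [].
have [s|ns] := pselect (psat phi (fun=> a)); first by left.
by right.
Qed.

Definition same_over (A : set M) (a b : M) : Prop :=
  forall X, pdef A X -> X a -> X b.

Lemma same_overC (A : set M) a b X : same_over A a b -> pdef A X -> X b -> X a.
Proof.
by move=> ab dX Xb; apply: contrapT => /(ab _ (pdefC dX)).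
Qed.

Lemma pdef_psat (A : set M) (phi : pformula M 1) : Defs.over A phi ->
  pdef A [set a | psat phi (fun=> a)].
Proof. by move=> phiA; exists phi. Qed.

Lemma same_over_tpeq V (v : V -> M) a b : same_over (range v) a b ->
  tpeq (ext a v) (ext b v).
Proof.
move=> ab; apply: tpeqP => n phi g sa.
by apply: (ab [set x | sat phi (ext x v \o g)]) => //;
  exact: (pdef_defn (defn_sat phi g)).
Qed.

(** The filter generated by tp(a/A). *)
Definition type_filter (A : set M) (a : M) : set_system M :=
  filter_from [set X | pdef A X /\ X a] id.

Lemma type_filter_filter A a : Filter (type_filter A a).
Proof.
apply: filter_from_filter; first by exists setT; split => //; exact: pdefT.
by move=> X Y [dX Xa] [dY Ya]; exists (X `&` Y) => //; split => //; exact: pdefI.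
Qed.

Lemma type_filter_infinite A a : ~ acl A a ->
  forall Y, type_filter A a Y -> infinite_set Y.
Proof.
move=> nA Y [X [dX Xa] XY] fY; apply: nA; apply/aclP; exists X; split => //.
exact: sub_finite_set fY.
Qed.

Section Saturated.
Context (K : Type).
Hypothesis K_inacc : strongly_inaccessible K.
Hypothesis M_sat : saturated K M.

Lemma sat_filter (A : set M) (F : set_system M) : small K A -> ProperFilter F ->
  exists a, forall X, pdef A X -> F X -> X a.
Proof.
move=> sA /ultraFilterLemma [U [Uultra FU]].
have UF : ProperFilter U by exact: ultra_proper.
pose p : set (pformula M 1) := [set phi | Defs.over A phi /\ U [set a | psat phi (fun=> a)]].
have cp : complete_type A p.
  split=> [phi []//|E Ep fE|phi phiA].
    have : U (\bigcap_(phi in E) [set a | psat phi (fun=> a)]).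
      by apply: (filter_finite_bigcap _ fE) => phi /Ep [].
    by move=> /filter_ex [a Ea]; exists (fun=> a).
  have [Up|UnP] := in_ultra_setVsetC [set a | psat phi (fun=> a)] Uultra; first by left.
  by right.
have [_ /(_ A p sA cp) [x xp]] := M_sat.
exists (x ord0) => X [phi [phiA Xphi]] FX; apply/Xphi.
rewrite (_ : (fun=> x ord0) = x); last by apply/funext => i; rewrite ord1.
apply: xp; split => //; apply: filterS (FU _ FX) => a; exact: (iffLR (Xphi a)).
Qed.

(** A non-principal ultrafilter contains the complement of every finite B-definable set, so a
    realization of its trace over the union of A and B lies outside [acl B]. *)
Lemma sat_filter_acl (A B : set M) (F : set_system M) : small K A -> small K B ->
  Filter F -> (forall X, F X -> infinite_set X) ->
  exists a, (forall X, pdef A X -> F X -> X a) /\ ~ acl B a.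
Proof.
move=> sA sB FF Finf; have [U [Uultra FU Uinf]] := nonprincipal_ultrafilter FF Finf.
have UF : ProperFilter U by exact: ultra_proper.
have sAB : small K (A `|` B) by exact: small_setU.
have [a aP] := sat_filter sAB UF.
exists a; split => [X dX FX|/aclP [X [dX fX Xa]]].
  apply: aP; first by apply: pdef_sub dX => x; left.
  exact: FU.
suff : (~` X) a by apply.
apply: aP; first by apply: pdefC; apply: pdef_sub dX => x; right.
by case: (in_ultra_setVsetC X Uultra) => // /Uinf.
Qed.

Lemma same_over_ext (A B : set M) a : small K A -> small K B -> ~ acl A a ->
  exists b, same_over A a b /\ ~ acl B b.
Proof.
move=> sA sB nA; have [b [bP nB]] := sat_filter_acl sA sB (type_filter_filter A a)
  (type_filter_infinite nA).
by exists b; split => // X dX Xa; apply: bP => //; exists X.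
Qed.

Lemma infinite_same_over (A : set M) a : small K A -> ~ acl A a ->
  infinite_set [set b | same_over A a b].
Proof.
move=> sA nA fin; have sB := small_finite K_inacc fin.
have [b [ab nb]] := same_over_ext sA sB nA.
by apply: nb; exact: acl_refl.
Qed.

End Saturated.
End Over.

Section Realize.
Context (K : Type) (L : language) (T : theory L) (M : structure L).
Hypothesis K_inacc : strongly_inaccessible K.
Hypothesis M_sat : saturated K M.
Hypothesis MT : models T M.
Hypothesis T_complete : complete_theory T.

Lemma holds_transfer (N : structure L) phi : models T N -> holds N phi -> holds M phi.
Proof.
move=> NT Nphi; case: T_complete => _ /(_ phi) [/(_ M MT)//|/(_ N NT)].
by move/(_ Nphi).
Qed.

(* The variables are realized one at a time. *)
Lemma realize_filter_nat (N : structure L) (U : set_system (nat -> N)) :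
  models T N -> ProperFilter U ->
  exists m : nat -> M, forall P : (forall N : structure L, (nat -> N) -> Prop),
    defn P -> U [set v : nat -> N | P N v] -> P M m.
Proof.
move=> NT UF.
pose Inv n (w : nat -> M) := forall P : (forall N : structure L, ('I_n -> N) -> Prop),
  defn P -> U [set v : nat -> N | P N (v \o val)] -> P M (w \o val).
have [m0] := carrier_inhabited M.
(* Without variables the formulas are sentences, and completeness of T carries them from N to M. *)
have inv0 : Inv 0 (fun=> m0).
  move=> P [n [phi [g Pg]]] /filter_ex [v /Pg].
  have n0 : n = 0 by case: n phi g {Pg} => // n phi g; case: (g ord0).
  subst n => sv; apply/Pg; have : holds N phi.
    by rewrite /holds (_ : @vnil N = (v \o val) \o g) //; apply/funext => -[].
  move=> /(holds_transfer NT); rewrite /holds (_ : @vnil M = ((fun=> m0) \o val) \o g) //.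
  by apply/funext => -[].
pose upd (w : nat -> M) n a i := if i == n then a else w i.
have step n w : Inv n w -> exists a, Inv n.+1 (upd w n a).
  move=> inv; pose D := [set P : (forall N : structure L, (option 'I_n -> N) -> Prop) |
    defn P /\ U [set v : nat -> N | P N (ext (v n) (v \o val))]].
  pose F := filter_from D (fun P => [set a | P M (ext a (w \o val))]).
  have FF : ProperFilter F.
    apply: filter_from_proper; last first.
      move=> P [dP UP]; apply: (inv (fun N v => exists a, P N (ext a v))).
        exact: defn_ex.
      by apply: filterS UP => v Pv; exists (v n).
    apply: filter_from_filter.
      exists (fun N v => True); split; first exact: defn_True.
      by apply: filterS filterT => v _.
    move=> P Q [dP UP] [dQ UQ]; exists (fun N v => P N v /\ Q N v) => //.
    by split; [exact: defn_and|apply: filterS (filterI UP UQ)].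
  have sA : small K (range (fun i : 'I_n => w i)).
    apply: small_finite => //; exact/finite_image/finite_finset.
  have [a aP] := sat_filter M_sat sA FF; exists a => P dP UP.
  pose h (i : 'I_n.+1) := unlift ord_max i.
  have hE (X : Type) (b : X) (u : nat -> X) :
      ext b (u \o val) \o h = (fun i => if i == n then b else u i) \o val.
    apply/funext => i /=; rewrite /h; case: (unliftP ord_max i) => [j ->|->] /=.
      by rewrite /bump leqNgt ltn_ord /= add0n (ltn_eqF (ltn_ord j)).
    by rewrite eqxx.
  pose Q (N : structure L) (v : option 'I_n -> N) := P N (v \o h).
  have dQ : defn Q by exact: (defn_comp h dP).
  have QE x : Q M (ext x (w \o val)) = P M (upd w n x \o val) by rewrite /Q hE.
  rewrite -QE; apply: (aP [set x | Q M (ext x (w \o val))]).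
    by apply: (pdef_defn dQ) => i; exists i.
  exists Q => //; split => //; apply: filterS UP => v /=; rewrite /Q hE.
  congr (P N _); apply/funext => i /=.
  by case: eqP => // ->.
have /choice [nxt nxtP] : forall p : nat * (nat -> M), exists a,
    Inv p.1 p.2 -> Inv p.1.+1 (upd p.2 p.1 a).
  move=> [n w]; have [/step [a aP]|ni] := pselect (Inv n w); first by exists a.
  by exists m0.
pose W := fix W n := if n is n'.+1 then upd (W n') n' (nxt (n', W n')) else fun=> m0.
have WInv n : Inv n (W n).
  by elim: n => [//|n IH]; exact: (nxtP (n, W n) IH).
pose m n := W n.+1 n.
have Wm n i : (i < n)%N -> W n i = m i.
  elim: n => // n IH; rewrite ltnS leq_eqVlt => /orP [/eqP ->//|ilt].
  by rewrite /= /upd (ltn_eqF ilt) IH.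
exists m => P [n [phi [g Pg]]] UP.
pose b := (\max_i g i).+1.
have gb i : (g i < b)%N by rewrite ltnS; exact: leq_bigmax.
pose g' i : 'I_b := Ordinal (gb i).
apply/Pg; have := WInv b _ (defn_sat phi g').
rewrite (_ : (W b \o val) \o g' = m \o g); last first.
  by apply/funext => i; exact: (Wm b _ (gb i)).
by apply; apply: filterS UP => v /Pg.
Qed.

Lemma realize_filter (N : structure L) (V : countType) (U : set_system (V -> N)) :
  models T N -> ProperFilter U ->
  exists m : V -> M, forall P : (forall N : structure L, (V -> N) -> Prop),
    defn P -> U [set v : V -> N | P N v] -> P M m.
Proof.
move=> NT UF; have [n0] := carrier_inhabited N.
pose e (v : V -> N) (n : nat) := if unpickle n is Some x then v x else n0.
have eE v : e v \o pickle = v by apply/funext => x; rewrite /e /= pickleK.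
have eUF : ProperFilter (fmap e U) by exact: fmap_proper_filter.
have [m mP] := realize_filter_nat NT eUF.
exists (m \o pickle) => P dP UP; apply: (mP (fun N u => P N (u \o pickle))).
  exact: defn_comp.
suff : U [set v : V -> N | P N (e v \o pickle)] by [].
by apply: filterS UP => v Pv; rewrite /mkset eE.
Qed.

Lemma realize_tuple (N : structure L) (V : countType) (v : V -> N) : models T N ->
  exists w : V -> M, tpeq v w.
Proof.
move=> NT; have [m mP] := realize_filter NT (principal_filter_proper v).
exists m; apply: tpeqP => n phi g sv; apply: (mP (fun N u => sat phi (u \o g))).
  exact: defn_sat.
exact/principal_filterP.
Qed.

End Realize.

(** * Consequences of rank one *)

Section RankOne.
Context (K : Type) (L : language) (T : theory L) (M : structure L).
Hypothesis K_inacc : strongly_inaccessible K.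
Hypothesis M_sat : saturated K M.
Hypothesis M_rank : SU_formula_eq K 1 set0 (x_eq_x M).

(* Otherwise P(x, b_0) divides over the empty set; a generic solution a of it
   then starts a forking chain tp(a) , tp(a / b_0), tp(a / b_0 a) of length 2. *)
Lemma common_solution (V : Type) (P : forall N : structure L, (option V -> N) -> Prop)
    (b : nat -> V -> M) k : defn P -> (forall i j, tpeq (b i) (b j)) ->
  infinite_set [set x | P M (ext x (b 0))] ->
  exists (f : 'I_k -> nat) x, injective f /\ forall j, P M (ext x (b (f j))).
Proof.
move=> [n [phi [g Pg]]] bb Pinf; apply: contrapT => noc.
have [m [psi [h psih]]] := sat_option phi g.
have vE (a : M) (w : 'I_m -> M) : @vcat M 1 m (fun=> a) w = vcons a w.
  apply/funext => i; case: (unliftP ord0 i) => [j ->|->].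
    by rewrite vconsS (_ : lift ord0 j = rshift 1 j) ?vcat_rshift //; exact: val_inj.
  by rewrite vcons0 (_ : ord0 = lshift m (ord0 : 'I_1)) ?vcat_lshift //; exact: val_inj.
pose pf i := @PFormula L M 1 m psi (b i \o h).
have pfE i x : psat (pf i) (fun=> x) <-> P M (ext x (b i)).
  by rewrite Pg psih /psat /= vE.
pose B := range (b 0 \o h).
have sB : small K B by apply: small_finite => //; exact/finite_image/finite_finset.
have dX : pdef B [set x | P M (ext x (b 0))].
  exists (pf 0); split; first by move=> i; exists i.
  by move=> x; rewrite /= pfE.
have [a [aP nBa]] : exists a, P M (ext a (b 0)) /\ ~ acl B a.
  have FF : Filter (filter_from [set: unit] (fun=> [set x | P M (ext x (b 0))])).
    by apply: filter_from_filter => [|i j _ _]; [exists tt|exists tt].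
  have [|a [aP nBa]] := sat_filter_acl K_inacc M_sat sB sB FF.
    by move=> X [_ _ PX] fX; apply: Pinf; exact: sub_finite_set fX.
  by exists a; split => //; apply: (aP _ dX); exists tt.
case: M_rank => _; apply; exists (type_of set0 a); split.
  by split => // -[].
split; first exact: complete_type_of.
exists B, (type_of B a); split => //.
- by move=> phi' [o s]; split => // i; case: (o i).
(* First link: [P(x, b 0)] divides over the empty set, witnessed by the conjugates [b i], no k of
   which have a common solution. *)
- exists 1, (fun=> pf 0); split => [_|x xr]; last first.
    by exists ord0; apply: xr; split; [move=> i; exists i|apply/pfE].
  exists k, (fun i => b i \o h); split => [i chi ochi|f fI [x xP]].
    have p0 (j : 'I_(plen chi)) : False by case: (ochi j).
    pose c (j : 'I_(m + plen chi)) : V := match fintype.split j with inl i => h i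
      | inr j => False_rect V (p0 j) end.
    have cE j' : vcat (b j' \o h) (pparam chi) = b j' \o c.
      by apply/funext => j; rewrite /vcat /c /=; case: (fintype.split j) => // j''; case: (p0 j'').
    by rewrite /psat /= !cE; exact: bb.
  apply: noc; exists f, (x ord0); split => // j.
  apply/pfE; have := xP j; rewrite (_ : (fun=> x ord0) = x) //.
  by apply/funext => i; rewrite ord1.
- split; first exact: complete_type_of.
  (* Second link: a is not algebraic over B, so it has infinitely many conjugates [e i] over B, and
     the formula x = a divides over B with k = 2. *)
  have inf := infinite_same_over K_inacc M_sat sB nBa.
  have [e [eI eP]] := infinite_inj inf.
  pose eqf (c : M) := @PFormula L M 1 1 (Equal (Var (lshift 1 ord0)) (Var (rshift 1 ord0))) (fun=> c).
  have eqfE c x : psat (eqf c) x <-> x ord0 = c.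
    by rewrite /psat /= vcat_lshift vcat_rshift.
  exists (B `|` [set a]), (type_of (B `|` [set a]) a); split.
  + by move=> x; left.
  + by apply: small_setU => //; exact/small_finite/finite_set1.
  + by move=> phi' [o s]; split => // i; left; exact: o.
  + exists 1, (fun=> eqf a); split => [_|x xr]; last first.
      exists ord0; apply: xr; split; first by move=> i; right.
      exact/eqfE.
    exists 2, (fun i => (fun=> e i)); split => [i chi ochi|f fI [x xP]].
      rewrite (_ : pparam (eqf a) = fun=> a) //.
      split; last exact: (eP i _ (pdef_psat ochi)).
      by move=> s; apply: (same_overC (eP i) (pdef_psat ochi)).
    have e01 : e (f ord0) = e (f ord_max).
      by have /eqfE <- := xP ord0; have /eqfE <- := xP ord_max.
    by have := fI _ _ (eI _ _ e01).
  + exact: complete_type_of.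
Qed.

(** Let [Q(y; a)] say that a satisfies the algebraic formula with y in place of b, and that this
    formula has fewer than k solutions. If b were not algebraic over u and a, the sets [Q(y; e i)],
    for conjugates [e i] of a over u, would be infinite; k of them would have a common point y,
    which then has k solutions. *)
Lemma acl_exchange_tuple (V : Type) (u : V -> M) (a b : M) : small K (range u) ->
  acl (range u `|` [set b]) a -> ~ acl (range u) a -> acl (range u `|` [set a]) b.
Proof.
rewrite -!range_ext => su /aclP [X [dX /finite_atleast [k nk] Xa]] nua.
apply: contrapT => nub.
have [P [dP PX]] : exists P : (forall N : structure L, (option (option V) -> N) -> Prop),
    defn P /\ forall x, P M (ext x (ext b u)) <-> X x.
  have /pdefP [P [dP XP]] := dX.
  have /choice [g gP] : forall x : range (ext b u), exists i, ext b u i = val x.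
    by move=> x; have /set_mem [i _ e] := valP x; exists i.
  exists (fun N v => P N (v \o omap g)); split; first exact: (defn_comp (omap g) dP).
  move=> x; rewrite XP (_ : _ \o omap g = ext x val) //.
  by apply/funext => -[y|] //=; exact: gP.
pose R (N : structure L) (w : option (option V) -> N) :=
  P N w /\ ~ atleast k [set c | P N (ext c (w \o Some))].
pose sw (o : option (option V)) : option (option V) :=
  match o with Some (Some x) => Some (Some x) | Some None => None | None => Some None end.
pose Q (N : structure L) (w : option (option V) -> N) := R N (w \o sw).
have dQ : defn Q.
  apply: (defn_comp sw); apply: defn_and => //.
  exact: (defn_comp Some (defn_not (defn_atleast k dP))).
have swE c y : ext y (ext c u) \o sw = ext c (ext y u) :> (option (option V) -> M).
  by apply/funext => -[[]|].
have inf : infinite_set [set b' | same_over (range u) a b'].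
  exact: (infinite_same_over K_inacc M_sat).
have [e [eI eP]] := infinite_inj inf.
have Rab : Q M (ext b (ext a u)).
  rewrite /Q swE; split; first exact/PX.
  suff -> : [set c | P M (ext c (ext a (ext b u) \o Some))] = X by [].
  apply/seteqP; split => c; first exact: (iffLR (PX c)).
  exact: (iffRL (PX c)).
have ee i : tpeq (ext a u) (ext (e i) u) by apply: same_over_tpeq; exact: eP.
have [] := @common_solution _ Q (fun i => ext (e i) u) k dQ.
- by move=> i j; apply: tpeq_trans (ee j); exact/tpeq_sym/ee.
- move=> fin; apply: nub.
  have /finite_atleast [l nl] := fin.
  apply/aclP; exists [set y | Q M (ext y (ext a u))]; split => //.
    by apply: (pdef_defn dQ) => i; exists i.
  apply/finite_atleast; exists l => al; apply: nl.
  exact: (iffLR (tpeq_defn (ee 0) (defn_atleast l dQ)) al).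
- move=> f [y [fI fP]].
  have [k0|kpos] := posnP k.
    by apply: nk; rewrite k0; exists (fun i => a); split => [i|i]; case: i.
  have := fP (Ordinal kpos); rewrite /Q swE => -[_ /=]; apply.
  exists (fun j => e (f j)); split => [i j /eI /fI //|j].
  by have := fP j; rewrite /Q swE => -[].
Qed.

End RankOne.

Section Exchange.
Context (K : Type) (L : language) (T : theory L) (M : structure L).
Hypothesis K_inacc : strongly_inaccessible K.
Hypothesis M_monster : monster K T M.
Hypothesis T_complete : complete_theory T.
Hypothesis T_rank : SU_rank_one K T.

(** Only finitely many elements of N matter; a tuple of the same type in M carries the problem to
    the saturated model and [acl_tpeq] brings the answer back. *)
Lemma acl_exchange (N : structure L) (A : set N) a b : models T N ->
  acl (A `|` [set b]) a -> ~ acl A a -> acl (A `|` [set a]) b.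
Proof.
move=> NT Aba nAa; case: (M_monster) => MT M_sat.
have M_rank : SU_formula_eq K 1 set0 (x_eq_x M) by case: T_rank => _; apply.
have [B [fB BA Bba]] : exists B, [/\ finite_set B, B `<=` A & acl (B `|` [set b]) a].
  have [B [fB BA Ba]] := acl_finite Aba.
  exists (B `\ b); split.
  - exact: finite_setD.
  - by move=> x [/BA [//|->]] /(_ erefl).
  - apply: acl_sub Ba => x Bx; have [->|xb] := pselect (x = b); first by right.
    by left.
have nBa : ~ acl B a by move=> Ba; apply: nAa; exact: acl_sub Ba.
suff : acl (B `|` [set a]) b by apply: acl_sub => x [/BA|]; [left|right].
have [n [u BE]] := finite_set_range fB; rewrite BE -?range_ext in Bba nBa *.
have [w vw] := realize_tuple K_inacc M_sat MT T_complete (ext a (ext b u)) NT.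
pose w0 := w \o Some \o Some.
have wE : w = ext (w None) (ext (w (Some None)) w0) by apply/funext => -[[]|].
rewrite {}wE in vw; set a' := w None in vw; set b' := w _ in vw.
pose sw (o : option (option 'I_n)) : option (option 'I_n) :=
  match o with Some (Some x) => Some (Some x) | Some None => None | None => Some None end.
have swE (X : Type) (c y : X) z : ext y (ext c z) \o sw = ext c (ext y z).
  by apply/funext => -[[]|].
have vw2 : tpeq (ext b (ext a u)) (ext b' (ext a' w0)).
  by have := tpeq_comp sw vw; rewrite !swE.
have vw3 : tpeq (ext a u) (ext a' w0).
  exact: (tpeq_comp Some vw2).
apply: (acl_tpeq (tpeq_sym vw2)); rewrite range_ext.
apply: (@acl_exchange_tuple K L M) => //.
- by apply: small_finite => //; exact/finite_image/finite_finset.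
- by rewrite -range_ext; exact: (acl_tpeq vw).
- by move=> /(acl_tpeq (tpeq_sym vw3)).
Qed.

End Exchange.

(** * Bounding almost disjoint families *)

(** Each predicate halves the family, so each one doubles the length to start with. The conclusion
    says that every predicate is constant on the selected subfamily. *)
Lemma pigeonhole_predicates (A : Type) (D : set (A -> Prop)) : finite_set D ->
  forall r, exists N, forall f : 'I_N -> A, exists g : 'I_r -> 'I_N,
    injective g /\ forall th, D th -> forall i j, th (f (g i)) -> th (f (g j)).
Proof.
move=> fD; have [s sE] : exists s : seq {classic (A -> Prop)}, D = [set` s] by apply/finite_seqP.
rewrite {}sE {fD}; elim: s => [|th s IH] r; first by exists r => f; exists id; split => // th; rewrite set_nil.
have [N Nf] := IH (r + r)%N; exists N => f; have [g [gI gP]] := Nf f.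
have [Y [rY YX]] : exists Y : {set 'I_(r + r)}, (r <= #|Y|)%N /\
    {in Y &, forall i j, th (f (g i)) -> th (f (g j))}.
  pose X := [set i : 'I_(r + r) | `[< th (f (g i)) >]]%SET.
  have [rX|rX] := leqP r #|X|.
    exists X; split => // i j; rewrite !inE => _ /asboolP //.
  exists (~: X)%SET; split.
    have := cardsC X; rewrite card_ord => e.
    by rewrite -(leq_add2l #|X|) e leq_add2r ltnW.
  by move=> i j; rewrite !inE => /asboolPn.
exists (fun i => g (enum_val (widen_ord rY i))); split.
  move=> i j /gI /enum_val_inj /(congr1 val) /= /val_inj //.
move=> th'; rewrite /= in_cons => /orP [/eqP ->|/gP th's] i j; last exact: th's.
by apply: YX; exact: enum_valP.
Qed.

Section AlmostDisjoint.
Context (K : Type) (L : language) (T : theory L) (M : structure L).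
Hypothesis K_inacc : strongly_inaccessible K.
Hypothesis M_monster : monster K T M.
Hypothesis T_complete : complete_theory T.
Hypothesis T_rank : SU_rank_one K T.

(* Induction on the size k of the intersections: infinitely many b_i can be
   chosen with a common solution x and the same type over x, and removing x
   from the solution sets decreases k. *)
Lemma no_almost_disjoint_sequence k (V : countType)
    (P : forall N : structure L, (option V -> N) -> Prop) (b : nat -> V -> M) :
  defn P -> (forall i j, tpeq (b i) (b j)) ->
  infinite_set [set x | P M (ext x (b 0))] ->
  ~ (forall i j, i <> j -> ~ atleast k [set x | P M (ext x (b i)) /\ P M (ext x (b j))]).
Proof.
have [MT M_sat] := M_monster.
have M_rank : SU_formula_eq K 1 set0 (x_eq_x M) by case: T_rank => _; apply.
elim: k V P b => [|k IH] V P b dP bb Pinf dis.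
  by apply: (dis 0 1) => //; have [m0] := carrier_inhabited M; exists (fun=> m0); split => -[].
(* The variable [None] is the common solution, and [Some (i, v)] is the coordinate v of the i-th
   tuple. *)
pose W : countType := option (nat * V)%type.
pose xy i (o : option V) : W := if o is Some v then Some (i, v) else None.
pose yy i (v : V) : W := Some (i, v).
pose D := [set p : nat * set ((option V -> M) -> Prop) | finite_set p.2].
(* A finite part of the type to be realized: the first [p.1] tuples are distinct terms of the
   sequence b, they share the solution, and over it they agree on the finitely many predicates in
   [p.2]. *)
pose S (p : nat * set ((option V -> M) -> Prop)) := [set w : W -> M |
  (exists f : nat -> nat, (forall i j, (i < p.1)%N -> (j < p.1)%N -> f i = f j -> i = j) /\
     forall i, (i < p.1)%N -> w \o yy i = b (f i)) /\
  (forall i, (i < p.1)%N -> P M (w \o xy i)) /\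
  forall th, p.2 th -> forall i j, (i < p.1)%N -> (j < p.1)%N ->
    th (w \o xy i) -> th (w \o xy j)].
have FF : ProperFilter (filter_from D S).
  apply: filter_from_proper; last first.
    move=> [r De] /= fDe.
    have [N Nf] := pigeonhole_predicates fDe r.
    have [f [x [fI xP]]] := common_solution K_inacc M_sat M_rank N dP bb Pinf.
    have [g [gI gP]] := Nf (fun i => ext x (b (f i))).
    pose h (i : nat) : nat := if insub i is Some i' then f (g i') else 0.
    have hE (i : 'I_r) : h i = f (g i) by rewrite /h valK.
    pose w (o : W) : M := if o is Some p then b (h p.1) p.2 else x.
    have wE i : w \o xy i = ext x (b (h i)) by apply/funext => -[].
    exists w; split; last split.
    - exists h; split => // i j ir jr.
      by rewrite (hE (Ordinal ir)) (hE (Ordinal jr)) => /fI /gI /(congr1 val).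
    - by move=> i ir; rewrite wE (hE (Ordinal ir)); exact: xP.
    - move=> th Dth i j ir jr; rewrite !wE (hE (Ordinal ir)) (hE (Ordinal jr)).
      exact: gP.
  apply: filter_from_filter; first by exists (0, set0); exact: finite_set0.
  move=> [r De] [r' De'] /= fDe fDe'; exists (maxn r r', De `|` De').
    by rewrite /D /= finite_setU.
  have lr i : (i < r)%N -> (i < maxn r r')%N by move=> h; rewrite leq_max h.
  have lr' i : (i < r')%N -> (i < maxn r r')%N by move=> h; rewrite leq_max h orbT.
  move=> w [/= [f [fI fw]] [wP wD]]; split; split => //=.
  - exists f; split => [i j /lr + /lr|i /lr]; [exact: fI|exact: fw].
  - split => [i /lr|th Dth i j /lr + /lr]; first exact: wP.
    by apply: wD; left.
  - exists f; split => [i j /lr' + /lr'|i /lr']; [exact: fI|exact: fw].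
  - split => [i /lr'|th Dth i j /lr' + /lr']; first exact: wP.
    by apply: wD; right.
(* The realization keeps only first-order consequences: each tuple has the type of [b 0], all tuples
   have one type over the common solution, and the intersections keep their bound. The tuples
   themselves may be new. *)
have [w wP] := realize_filter K_inacc M_sat MT T_complete MT FF.
have wy i : tpeq (b 0) (w \o yy i).
  apply: tpeqP => n phi g s0; apply: (wP (fun N u => sat phi (u \o (yy i \o g)))).
    exact: defn_sat.
  exists (i.+1, set0); first exact: finite_set0.
  move=> /= u [[f [_ fu]] _] /=.
  rewrite (_ : u \o _ = b (f i) \o g); last by rewrite -(fu i).
  exact: (iffLR (bb 0 (f i) _ _ _)).
have wxP i : P M (w \o xy i).
  apply: (wP (fun N u => P N (u \o xy i))); first exact: defn_comp.
  exists (i.+1, set0); first exact: finite_set0.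
  by move=> /= u [_ [uP _]]; exact: uP.
have wxy i j : tpeq (w \o xy i) (w \o xy j).
  apply: tpeqP => n phi g; apply: (wP (fun N u => sat phi (u \o (xy i \o g)) -> sat phi (u \o (xy j \o g)))).
    by apply: defn_imp; exact: defn_sat.
  exists ((maxn i j).+1, [set (fun v : option V -> M => sat phi (v \o g))]).
    exact: finite_set1.
  by move=> u [_ [_ /(_ _ erefl i j)]]; apply; rewrite ltnS leq_max leqnn ?orbT.
have wdis i j : i <> j ->
    ~ atleast k.+1 [set x | P M (ext x (w \o yy i)) /\ P M (ext x (w \o yy j))].
  move=> ij.
  pose Q l (N : structure L) (v : option W -> N) := P N (v \o omap (yy l)).
  have dQ l : defn (Q l) by exact: (defn_comp (omap (yy l)) dP).
  have QE l (N : structure L) (x : N) u : Q l N (ext x u) = P N (ext x (u \o yy l)).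
    by congr (P N _); apply/funext => -[].
  have := wP _ (defn_not (defn_atleast k.+1 (defn_and (dQ i) (dQ j)))).
  rewrite /= (_ : [set a | _] = [set x | P M (ext x (w \o yy i)) /\ P M (ext x (w \o yy j))]); last first.
    by apply/seteqP; split => a /=; rewrite !QE.
  apply; exists ((maxn i j).+1, set0); first exact: finite_set0.
  move=> /= u [[f [fI fu]] _] /=.
  rewrite (_ : [set a | _] = [set x | P M (ext x (b (f i))) /\ P M (ext x (b (f j)))]).
    by apply: dis => /fI e; apply: ij; apply: e; rewrite ltnS leq_max leqnn ?orbT.
  by apply/seteqP; split => a /=; rewrite !QE !fu // ltnS leq_max leqnn ?orbT.
pose P' (N : structure L) (v : option (option V) -> N) :=
  P N (v \o omap Some) /\ ~ (v None = v (Some None)).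
have P'E x i : P' M (ext x (w \o xy i)) <-> P M (ext x (w \o yy i)) /\ x <> w None.
  by rewrite /P' (_ : _ \o omap Some = ext x (w \o yy i)) //; apply/funext => -[].
apply: (IH (option V) P' (fun i => w \o xy i)) => //.
- apply: defn_and; first exact: defn_comp.
  exact/defn_not/defn_eq.
- move=> fin; have : finite_set [set x | P M (ext x (w \o yy 0))].
    apply: (@sub_finite_set _ _ ([set x | P' M (ext x (w \o xy 0))] `|` [set w None])).
      move=> x Px; have [->|xw] := pselect (x = w None); first by right.
      by left; apply/P'E.
    by rewrite finite_setU; split => //; exact: finite_set1.
  move=> /finite_atleast [l nl]; apply: Pinf; apply/finite_atleast; exists l => al.
  by apply: nl; apply (tpeq_defn (wy 0) (defn_atleast l dP)).
(* The common solution belongs to every intersection and is excluded by [P'], so k further points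
   would make k + 1. *)
- move=> i j ij al; apply: (wdis i j ij); apply/atleastS; exists (w None); split.
    have xyE l : ext (w None) (w \o yy l) = w \o xy l by apply/funext => -[].
    by rewrite /= !xyE; split; exact: wxP.
  by apply: atleast_sub al => x [/P'E [? ?] /P'E []].
Qed.

End AlmostDisjoint.

(** * The number of formulas *)

Section SmallFormulas.
Context (K : Type) (L : language).
Hypothesis K_inacc : strongly_inaccessible K.
Hypothesis L_small : small K [set: symbols L].

Let label := (nat + symbols L)%type.

(** A term as a labelled tree, that is, a partial function from positions to labels. Such functions
    form a small type, so no finite word has to be decoded. *)
Fixpoint term_tree n (t : term L n) : seq nat -> option label :=
  match t with
  | Var i => fun p => if p is [::] then Some (inl (i : nat)) else None
  | App f ts => fun p => if p is j :: q then
      (if insub j is Some i then term_tree (ts i) q else None)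
      else Some (inr (inl f))
  end.

Lemma term_tree_inj n : injective (@term_tree n).
Proof.
elim=> [i|f ts IH] [j|g us] e.
- by have := congr1 (fun h => h [::]) e => -[] /val_inj ->.
- by have := congr1 (fun h => h [::]) e.
- by have := congr1 (fun h => h [::]) e.
- have := congr1 (fun h => h [::]) e => /= -[fg]; subst g.
  congr App; apply/funext => i; apply: IH; apply/funext => p.
  by have := congr1 (fun h => h ((i : nat) :: p)) e; rewrite /= valK.
Qed.

Fixpoint formula_tree n (phi : formula L n) : seq nat -> option label :=
  match phi with
  | Falsum _ => fun p => if p is [::] then Some (inl 0) else None
  | Equal _ s t => fun p => match p with
      | 0 :: q => term_tree s q | 1 :: q => term_tree t q
      | [::] => Some (inl 1) | _ => None end
  | Rel _ r ts => fun p => if p is j :: q then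
      (if insub j is Some i then term_tree (ts i) q else None)
      else Some (inr (inr r))
  | Imp _ s t => fun p => match p with
      | 0 :: q => formula_tree s q | 1 :: q => formula_tree t q
      | [::] => Some (inl 2) | _ => None end
  | All _ s => fun p => if p is j :: q then formula_tree s q else Some (inl 3)
  end.

Lemma formula_tree_inj n : injective (@formula_tree n).
Proof.
have ev (f g : seq nat -> option label) p : f = g -> f p = g p by move=> ->.
suff key : forall phi : formula L n, forall m (psi : formula L m) (e : n = m),
    formula_tree phi = formula_tree psi -> eq_rect n (formula L) phi m e = psi.
  by move=> phi psi; exact: (key phi n psi erefl).
elim=> {n} [n|n s t|n r ts|n p IHp q IHq|n p IHp] m psi;
  case: psi => {m} [m|m s' t'|m r' ts'|m p' q'|m p'] e E;
  have := ev _ _ [::] E => //=; subst m => //=.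
- by move=> _; congr Equal; apply: term_tree_inj; apply/funext => x;
    [exact: (ev _ _ (0 :: x) E)|exact: (ev _ _ (1 :: x) E)].
- move=> -[re]; subst r'; congr Rel; apply/funext => i.
  by apply: term_tree_inj; apply/funext => x; have := ev _ _ ((i : nat) :: x) E; rewrite /= valK.
- move=> _; congr Imp; [apply: (IHp _ p' erefl)|apply: (IHq _ q' erefl)]; apply/funext => x.
    exact: (ev _ _ (0 :: x) E).
  exact: (ev _ _ (1 :: x) E).
- by move=> _; congr All; apply: (IHp _ p' erefl); apply/funext => x; exact: (ev _ _ (0 :: x) E).
Qed.

Lemma small_formula n : small K [set: formula L n].
Proof.
apply: (small_inj (@formula_tree_inj n)); apply: small_fun => //.
  by apply: small_seq => //; exact: small_nat.
by apply: small_option => //; apply: small_sum => //; exact: small_nat.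
Qed.

(** The predicates in [defn] range over all structures and cannot be counted. Codes form a small
    type and can serve as colours. *)
Definition code (V : Type) := {n & (formula L n * ('I_n -> V))%type}.

Lemma small_code (V : Type) : small K [set: V] -> small K [set: code V].
Proof.
move=> sV; apply: small_sigT => // [|n]; first exact: small_nat.
apply: small_prod => //; first exact: small_formula.
by apply: small_fun => //; exact/small_finite/finite_finset.
Qed.

End SmallFormulas.

Definition code_sat (L : language) (V : Type) (c : code L V) (N : structure L)
  (v : V -> N) : Prop := sat (projT2 c).1 (v \o (projT2 c).2).

Lemma defn_code_sat (L : language) (V : Type) (c : code L V) : defn (@code_sat L V c).
Proof. exact: defn_sat. Qed.

Lemma defn_code (L : language) (V : Type) (P : forall N : structure L, (V -> N) -> Prop) :
  defn P -> exists c : code L V, forall N v, P N v <-> code_sat c v.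
Proof.
by move=> [n [phi [g Pg]]]; exists (existT _ n (phi, g)).
Qed.

Lemma pdef_code (L : language) (N : structure L) (V : Type) (v : V -> N) (X : set N) :
  pdef (range v) X -> exists c : code L (option V), forall x, X x <-> code_sat c (ext x v).
Proof.
move=> /pdefP [P [dP XP]].
have /choice [g gP] : forall x : range v, exists i, v i = val x.
  by move=> x; have /set_mem [i _ e] := valP x; exists i.
have [c cP] := defn_code (defn_comp (omap g) dP); exists c => x.
rewrite XP -cP (_ : ext x v \o omap g = ext x val) //.
by apply/funext => -[y|] //=; exact: gP.
Qed.

Section Bounded.
Context (K : Type) (L : language) (T : theory L) (M : structure L).
Hypothesis K_inacc : strongly_inaccessible K.
Hypothesis L_small : small K [set: symbols L].
Hypothesis M_monster : monster K T M.
Hypothesis T_complete : complete_theory T.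
Hypothesis T_rank : SU_rank_one K T.

(** A pair is coloured by two formulas, a bound on the intersection of their solution sets, and the
    types of both members. Homogeneity fixes the formulas and the bound, and leaves infinitely many
    conjugate members. *)
Lemma no_large_almost_disjoint_family : exists S : Type, small K [set: S] /\
  forall (u : S -> nat -> M) (d : S -> M), (forall s, ~ acl (range (u s)) (d s)) ->
  ~ forall s t, s <> t -> exists X Y, [/\ pdef (range (u s)) X, X (d s),
      pdef (range (u t)) Y, Y (d t) & finite_set (X `&` Y)].
Proof.
pose C := code L (option nat).
have sC : small K [set: C].
  by apply: small_code => //; apply: small_option => //; exact: small_nat.
pose Col := (C * C * nat * (set C * set C))%type.
have sCol : small K [set: Col].
  have sPC := small_powerset K_inacc sC.
  apply: small_prod => //; last exact: small_prod.
  apply: small_prod => //; [exact: small_prod|exact: small_nat].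
have [S [sS SP]] := exists_homogeneous_type K_inacc sCol.
exists S; split => // u d nd dis.
pose tp s : set C := [set c | code_sat c (ext (d s) (u s))].
pose good s t (c1 c2 : C) k := [/\ tp s c1, tp t c2 &
  ~ atleast k [set x | code_sat c1 (ext x (u s)) /\ code_sat c2 (ext x (u t))]].
have /choice [col colP] : forall p : S * S, exists q : C * C * nat,
    p.1 <> p.2 -> good p.1 p.2 q.1.1 q.1.2 q.2.
  move=> [s t]; have [e|st] := pselect (s = t).
    by exists (existT _ 0 (Falsum, @vnil _), existT _ 0 (Falsum, @vnil _), 0) => /(_ e).
  have [X [Y [/pdef_code [c1 Xc1] Xd /pdef_code [c2 Yc2] Yd /finite_atleast [k nk]]]] := dis s t st.
  exists (c1, c2, k) => _; split; [exact/Xc1|exact/Yc2|].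
  by apply: contra_not nk; apply: atleast_sub => x [/Xc1 ? /Yc2 ?].
have [s [[[[c1 c2] k] [t1 t2]] [sI hom]]] := SP (fun s t => (col (s, t), (tp s, tp t))).
(* Only one orientation of each pair is known to have the fixed colour, so a member may have either
   of the two recorded types; infinitely many share one of them. *)
have [t [s' [s'I [s't hom']]]] : exists t s', injective s' /\ (forall i : nat, tp (s' i) = t) /\
    forall i j, i <> j -> good (s' i) (s' j) c1 c2 k \/ good (s' j) (s' i) c1 c2 k.
  have hg i j : i <> j -> good (s i) (s j) c1 c2 k \/ good (s j) (s i) c1 c2 k.
    move=> ij; case: (hom i j ij) => [] [e _ _]; [left|right].
      by have := colP (s i, s j); rewrite e; apply => /sI.
    by have := colP (s j, s i); rewrite e; apply => /sI /esym.
  have t12 i : tp (s i) = t1 \/ tp (s i) = t2.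
    have : i <> i.+1 by apply/eqP; rewrite ltn_eqF.
    by move=> /hom [] [_ e1 e2]; [left|right].
  have sub t : infinite_set [set i | tp (s i) = t] ->
      exists t s', injective s' /\ (forall i : nat, tp (s' i) = t) /\
    forall i j, i <> j -> good (s' i) (s' j) c1 c2 k \/ good (s' j) (s' i) c1 c2 k.
    move=> /infinite_inj [f [fI ft]]; exists t, (s \o f); split => [i j /sI /fI//|].
    by split => // i j ij; apply: hg => /fI.
  have [|fin1] := pselect (infinite_set [set i | tp (s i) = t1]); first exact: sub.
  apply: (sub t2) => fin2; apply: infinite_nat.
  apply: (@sub_finite_set _ _ ([set i | tp (s i) = t1] `|` [set i | tp (s i) = t2])).
    by move=> i _; case: (t12 i); [left|right].
  by rewrite finite_setU; split => //; exact: contrapT.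
have c12 i : tp (s' i) c1 /\ tp (s' i) c2.
  by rewrite s't -{1}(s't 0) -(s't 1); case: (hom' 0 1) => // -[h1 h2 _];
    rewrite !s't in h1 h2 *.
(* The conjunction is symmetric, so its intersections are bounded whichever orientation carries the
   colour. *)
pose P (N : structure L) (v : option nat -> N) := code_sat c1 v /\ code_sat c2 v.
have dP : defn P by apply: defn_and; exact: defn_code_sat.
have tpu i j : tpeq (u (s' i)) (u (s' j)).
  apply: tpeqP => n phi g h.
  have : tp (s' i) (existT _ n (phi, Some \o g)) by [].
  by rewrite s't -(s't j).
apply: (@no_almost_disjoint_sequence K L T M K_inacc M_monster T_complete T_rank k nat P
  (fun i => u (s' i))) => //.
- move=> fin; apply: (nd (s' 0)); apply/aclP.
  exists [set x | P M (ext x (u (s' 0)))]; split => //; last exact: c12.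
  by apply: (pdef_defn dP) => i; exists i.
- move=> i j ij al; case: (hom' i j ij) => -[_ _]; apply.
    by apply: atleast_sub al => x [[? _] [_ ?]].
  by apply: atleast_sub al => x [[_ ?] [? _]].
Qed.

End Bounded.

(** * Elementary equivalence of H-structures *)

Section TransferType.
Context (L : language) (V : Type) (N1 N2 : structure L) (v : V -> N1) (w : V -> N2) (a : N1).
Hypothesis vw : tpeq v w.

(** The image of tp(a/v) under the elementary map that sends v to w. *)
Definition transfer_type : set (pformula N2 1) :=
  [set phi | Defs.over (range w) phi /\
    exists P : (forall N : structure L, (option V -> N) -> Prop),
      [/\ defn P, P N1 (ext a v) & forall x, psat phi (fun=> x) <-> P N2 (ext x w)]].

Lemma complete_transfer_type : complete_type (range w) transfer_type.
Proof.
split=> [phi []//|E Ep fE|phi phiw].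
  pose D := [set P : (forall N : structure L, (option V -> N) -> Prop) | defn P /\ P N1 (ext a v)].
  pose F := filter_from D (fun P => [set x | P N2 (ext x w)]).
  have FF : ProperFilter F.
    apply: filter_from_proper; last first.
      by move=> P [dP Pa]; apply (tpeq_defn vw (defn_ex dP)); exists a.
    apply: filter_from_filter.
      by exists (fun N v => True); split => //; exact: defn_True.
    move=> P Q [dP Pa] [dQ Qa]; exists (fun N v => P N v /\ Q N v) => //.
    by split => //; exact: defn_and.
  have : F (\bigcap_(phi in E) [set x | psat phi (fun=> x)]).
    apply: (filter_finite_bigcap _ fE) => phi /Ep [_ [P [dP Pa Pphi]]].
    by exists P => // x /Pphi.
  by move=> /filter_ex [x Ex]; exists (fun=> x).
have [c cP] := pdef_code (pdef_psat phiw).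
have [ca|nca] := pselect (code_sat c (ext a v)).
  by left; split => //; exists (@code_sat L _ c); split => //; exact: defn_code_sat.
right; split => //; exists (fun N v => ~ code_sat c v); split => //.
  exact/defn_not/defn_code_sat.
by move=> x; rewrite -cP.
Qed.

Lemma nonalgebraic_transfer_type : ~ acl (range v) a -> nonalgebraic_type transfer_type.
Proof.
move=> na phi [phiw [P [dP Pa Pphi]]] /algebraicP /finite_atleast [k nk]; apply: na.
apply/aclP; exists [set x | P N1 (ext x v)]; split => //.
  by apply: (pdef_defn dP) => i; exists i.
apply/finite_atleast; exists k => al; apply: nk.
have : atleast k [set x | P N2 (ext x w)] by apply (tpeq_defn vw (defn_atleast k dP)).
by apply: atleast_sub => x /Pphi.
Qed.

Lemma realizes_transfer_type b : realizes transfer_type (fun=> b) ->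
  tpeq (ext a v) (ext b w).
Proof.
move=> br; apply: tpeqP => n phi g sa.
have [|pf [pfw pfP]] := @pdef_defn L N2 V (fun N u => sat phi (u \o g)) (range w) w
  (defn_sat phi g); first by move=> i; exists i.
have /pfP // : psat pf (fun=> b).
apply: br; split => //; exists (fun N u => sat phi (u \o g)).
by split => //; [exact: defn_sat|move=> x; rewrite -pfP].
Qed.

(* An isolating formula is one with the least number of solutions. *)
Lemma transfer_algebraic : acl (range v) a -> exists b, tpeq (ext a v) (ext b w).
Proof.
move=> /aclP [X [/pdef_code [c cX] /finite_atleast [k0 nk0] Xa]].
pose D k := `[< exists P : (forall N : structure L, (option V -> N) -> Prop),
  [/\ defn P, P N1 (ext a v) & ~ atleast k [set x | P N1 (ext x v)]] >].
have exD : exists k, D k.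
  exists k0; apply/asboolP; exists (@code_sat L _ c); split; [exact: defn_code_sat|exact/cX|].
  by apply: contra_not nk0; apply: atleast_sub => x /cX.
case: (ex_minnP exD) => -[|k] /asboolP [P [dP Pa nk]] kmin.
  by case: nk; exists (fun=> a); split => -[].
have [b Pb] : exists b, P N2 (ext b w).
  by apply (tpeq_defn vw (defn_ex dP)); exists a.
exists b; apply: tpeqP => n phi g sa.
have PQ : forall x, P N1 (ext x v) -> sat phi (ext x v \o g).
  move=> x Px; apply: contrapT => nx; apply: nk; apply/atleastS; exists x; split => //.
  suff : atleast k [set x | P N1 (ext x v) /\ sat phi (ext x v \o g)].
    by apply: atleast_sub => y [Py sy]; split => // yx; apply: nx; rewrite -yx.
  apply: contrapT => nk'; suff /kmin : D k by rewrite ltnn.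
  apply/asboolP; exists (fun N u => P N u /\ sat phi (u \o g)).
  by split => //; apply: defn_and => //; exact: defn_sat.
exact: (iffLR (tpeq_defn vw (defn_all (defn_imp dP (defn_sat phi g)))) PQ b Pb).
Qed.

End TransferType.

Section BackForth.
Context (K : Type) (L : language) (T : theory L) (M : structure L).
Hypothesis K_inacc : strongly_inaccessible K.
Hypothesis M_monster : monster K T M.
Hypothesis T_complete : complete_theory T.
Hypothesis T_rank : SU_rank_one K T.

Definition free_tuple (N : structure L) (D : set N) (V : Type) (v : V -> N) : Prop :=
  forall h, D h -> ~ range v h -> ~ acl (range v `|` (D `\ h)) h.

Definition matching (N1 N2 : structure L) (D1 : set N1) (D2 : set N2) (V : Type)
    (v : V -> N1) (w : V -> N2) : Prop :=
  [/\ finite_set (range v) /\ finite_set (range w), tpeq v w,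
      forall i, D1 (v i) <-> D2 (w i), free_tuple D1 v & free_tuple D2 w].

Lemma matching_sym (N1 N2 : structure L) (D1 : set N1) (D2 : set N2) (V : Type)
    (v : V -> N1) (w : V -> N2) : matching D1 D2 v w -> matching D2 D1 w v.
Proof.
by move=> [[? ?] /tpeq_sym ? e ? ?]; split => // i; split=> /e.
Qed.

(** Freeness decides D on the algebraic closure of the tuple: only coordinates of the tuple can
    belong to D there. *)
Lemma free_tuple_acl (N : structure L) (D : set N) (V : Type) (v : V -> N) h :
  free_tuple D v -> D h -> acl (range v) h -> range v h.
Proof.
move=> fv Dh hv; apply: contrapT => nv; apply: (fv h Dh nv).
by apply: acl_sub hv => x; left.
Qed.

Lemma free_tuple_ext_in (N : structure L) (D : set N) (V : Type) (v : V -> N) a :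
  free_tuple D v -> D a -> free_tuple D (ext a v).
Proof.
move=> fv Da h Dh; rewrite range_ext => nh; have nvh : ~ range v h by move=> vh; apply: nh; left.
move=> ah; apply: (fv h Dh nvh); apply: acl_sub ah => x [[vx|->]|Dx]; [by left| |by right].
by right; split => // ah; apply: nh; right.
Qed.

Lemma free_tuple_ext_acl (N : structure L) (D : set N) (V : Type) (v : V -> N) a :
  free_tuple D v -> acl (range v) a -> free_tuple D (ext a v).
Proof.
move=> fv va h Dh; rewrite range_ext => nh; have nvh : ~ range v h by move=> vh; apply: nh; left.
move=> ah; apply: (fv h Dh nvh); apply: (@acl_trans1 _ _ _ _ a).
  by apply: acl_sub ah => x [[vx|->]|Dx]; [left; left|right|left; right].
by apply: acl_sub va => x; left.
Qed.

(** By exchange, an element h of D that became dependent after adding a would make a algebraic over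
    v and D. *)
Lemma free_tuple_ext_out (N : structure L) (D : set N) (V : Type) (v : V -> N) a :
  models T N -> free_tuple D v -> ~ acl (range v `|` D) a -> free_tuple D (ext a v).
Proof.
move=> NT fv na h Dh; rewrite range_ext => nh; have nvh : ~ range v h by move=> vh; apply: nh; left.
move=> ah; apply: na.
have : acl ((range v `|` D `\ h) `|` [set h]) a.
  apply: (acl_exchange K_inacc M_monster T_complete T_rank NT); last exact: fv.
  by apply: acl_sub ah => x [[vx|->]|Dx]; [left; left|right|left; right].
by apply: acl_sub => x [[vx|[Dx _]]|->]; [left|right|right].
Qed.

Section TwoStructures.
Context (N1 N2 : structure L) (D1 : set N1) (D2 : set N2).
Hypothesis H1 : H_structure T D1.
Hypothesis H2 : H_structure T D2.

Let N1T : models T N1. Proof. by case: H1. Qed.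
Let N2T : models T N2. Proof. by case: H2. Qed.

Lemma finite_range_ext (X V : Type) (x : X) (v : V -> X) :
  finite_set (range v) -> finite_set (range (ext x v)).
Proof. by rewrite range_ext finite_setU => fv; split => //; exact: finite_set1. Qed.

Lemma matching_ext V (v : V -> N1) (w : V -> N2) a b : matching D1 D2 v w ->
  tpeq (ext a v) (ext b w) -> (D1 a <-> D2 b) ->
  free_tuple D1 (ext a v) -> free_tuple D2 (ext b w) -> matching D1 D2 (ext a v) (ext b w).
Proof.
move=> [[fv fw] vw e gv gw] avbw ab ga gb; split => //.
  by split; exact: finite_range_ext.
by move=> [i|] //=; exact: e.
Qed.

Lemma matching_step_in V (v : V -> N1) (w : V -> N2) a : matching D1 D2 v w ->
  D1 a -> ~ range v a -> exists b, matching D1 D2 (ext a v) (ext b w).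
Proof.
move=> m Da nva; have [[fv fw] vw e gv gw] := m.
have na : ~ acl (range v) a by move=> /(free_tuple_acl gv Da).
have [_ _ dens _] := H2.
have [b [Db br]] := dens _ _ fw (complete_transfer_type a vw) (nonalgebraic_transfer_type vw na).
exists b; apply: matching_ext => //.
- exact: realizes_transfer_type.
- exact: free_tuple_ext_in.
- exact: free_tuple_ext_in.
Qed.

Lemma matching_step_out V (v : V -> N1) (w : V -> N2) a : matching D1 D2 v w ->
  ~ acl (range v `|` D1) a -> exists b, matching D1 D2 (ext a v) (ext b w).
Proof.
move=> m na; have [[fv fw] vw e gv gw] := m.
have nva : ~ acl (range v) a by apply: contra_not na; apply: acl_sub => x; left.
have [_ _ _ extn] := H2.
have [b [br nb]] := extn _ _ fw (complete_transfer_type a vw) (nonalgebraic_transfer_type vw nva).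
exists b; apply: matching_ext => //.
- exact: realizes_transfer_type.
- split=> [Da|Db]; first by case: na; apply: acl_refl; right.
  by case: nb; apply: acl_refl; right.
- exact: free_tuple_ext_out.
- exact: free_tuple_ext_out.
Qed.

Lemma matching_step_acl V (v : V -> N1) (w : V -> N2) a : matching D1 D2 v w ->
  acl (range v) a -> ~ range v a -> exists b, matching D1 D2 (ext a v) (ext b w).
Proof.
move=> m va nva; have [[fv fw] vw e gv gw] := m.
have [b ab] := transfer_algebraic vw va.
have wb : acl (range w) b := acl_tpeq ab va.
exists b; apply: matching_ext => //.
- split=> [Da|Db]; first by case: nva; exact: free_tuple_acl Da va.
  have [i _ wi] := free_tuple_acl gw Db wb; case: nva; exists i => //.
  exact: (iffRL (tpeq_defn ab (defn_eq L (Some i) None)) wi).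
- exact: free_tuple_ext_acl.
- exact: free_tuple_ext_acl.
Qed.

(** Adding an arbitrary point may force some elements of D into the tuple, so the back-and-forth
    system consists of parts of matched tuples. *)
Definition submatching V (v : V -> N1) (w : V -> N2) : Prop :=
  exists (V' : Type) (h : V -> V') v' w',
    [/\ matching D1 D2 v' w', v = v' \o h & w = w' \o h].

Lemma matching_add V (v : V -> N1) (w : V -> N2) (E : set N1) : matching D1 D2 v w ->
  finite_set E -> E `<=` D1 -> exists (V' : Type) (h : V -> V') v' w',
    [/\ matching D1 D2 v' w', v = v' \o h, w = w' \o h & E `<=` range v'].
Proof.
move=> m fE; have [s sE] : exists s : seq {classic N1}, E = [set` s] by apply/finite_seqP.
rewrite {}sE {fE}; elim: s => [|a s IH] sD.
  by exists V, id, v, w; split => // x; rewrite set_nil.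
have [|V' [h [v' [w' [m' vv' ww' sv']]]]] := IH.
  by move=> x xs; apply: sD; rewrite /= in_cons; apply/orP; right.
have Da : D1 a by apply: sD; rewrite /= in_cons eqxx.
have [va|nva] := pselect (range v' a).
  exists V', h, v', w'; split => // x; rewrite /= in_cons => /orP [/eqP ->//|]; exact: sv'.
have [b mb] := matching_step_in m' Da nva.
exists (option V'), (Some \o h), (ext a v'), (ext b w'); split => //.
rewrite range_ext => x; rewrite /mkset in_cons => /orP [/eqP ->|/sv' ?]; [by right|by left].
Qed.

(** If a is algebraic over the tuple and D, the finitely many elements of D involved are added by
    density, and a becomes algebraic over the tuple. Otherwise the extension property matches a. *)
Lemma submatching_forth V (v : V -> N1) (w : V -> N2) a : submatching v w ->
  exists b, submatching (ext a v) (ext b w).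
Proof.
move=> [V0 [h0 [v0 [w0 [m0 -> ->]]]]].
suff [V' [h [v' [w' [m' -> -> [i _ <-]]]]]] : exists (V' : Type) (h : V0 -> V') v' w',
    [/\ matching D1 D2 v' w', v0 = v' \o h, w0 = w' \o h & range v' a].
  exists (w' i), V', (ext i (h \o h0)), v', w'.
  by split => //; apply/funext => -[].
have one V1 (h1 : V0 -> V1) v1 w1 : v0 = v1 \o h1 -> w0 = w1 \o h1 ->
    (exists b, matching D1 D2 (ext a v1) (ext b w1)) ->
    exists (V' : Type) (h : V0 -> V') v' w',
    [/\ matching D1 D2 v' w', v0 = v' \o h, w0 = w' \o h & range v' a].
  move=> -> -> [b mb]; exists (option V1), (Some \o h1), (ext a v1), (ext b w1).
  by split => //; exists None.
have [av|nav] := pselect (acl (range v0 `|` D1) a); last first.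
  by apply: (one V0 id v0 w0) => //; exact: matching_step_out.
have [B [fB BvD Ba]] := acl_finite av.
have [||V1 [h1 [v1 [w1 [m1 vv1 ww1 Bv1]]]]] := matching_add m0 (E := B `&` D1).
- exact: finite_setIl.
- by move=> x [].
have av1 : acl (range v1) a.
  apply: acl_sub Ba => x Bx; have [Dx|nDx] := pselect (D1 x); first exact: Bv1.
  by case: (BvD x Bx) => // -[i _ <-]; exists (h1 i) => //; rewrite vv1.
have [va|nva] := pselect (range v1 a); first by exists V1, h1, v1, w1.
by apply: (one V1 h1 v1 w1) => //; exact: matching_step_acl.
Qed.

End TwoStructures.

Lemma submatching_sym (N1 N2 : structure L) (D1 : set N1) (D2 : set N2) V
    (v : V -> N1) (w : V -> N2) : submatching D1 D2 v w -> submatching D2 D1 w v.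
Proof.
move=> [V' [h [v' [w' [/matching_sym m -> ->]]]]].
by exists V', h, w', v'.
Qed.

Lemma submatching_comp (N1 N2 : structure L) (D1 : set N1) (D2 : set N2) V W (g : W -> V)
    (v : V -> N1) (w : V -> N2) : submatching D1 D2 v w ->
  submatching D1 D2 (v \o g) (w \o g).
Proof. by move=> [V' [h [v' [w' [m -> ->]]]]]; exists V', (h \o g), v', w'. Qed.

Lemma submatching_tpeq (N1 N2 : structure L) (D1 : set N1) (D2 : set N2) V
    (v : V -> N1) (w : V -> N2) : submatching D1 D2 v w -> tpeq v w.
Proof. by move=> [V' [h [v' [w' [[_ vw _ _ _] -> ->]]]]]; exact: tpeq_comp. Qed.

Fixpoint term_reduct n (t : term (add_pred L) n) : term L n :=
  match t with
  | Var i => Var i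
  | App f ts => @App L n f (fun i => term_reduct (ts i))
  end.

Lemma eval_reduct (N : structure L) (D : set N) n (v : 'I_n -> N) (t : term (add_pred L) n) :
  @eval _ (expand D) n v t = eval v (term_reduct t).
Proof.
elim: t => [//|f ts IH] /=; congr (fun_interp N f _); apply/funext => i; exact: IH.
Qed.

(** The value of a term is algebraic over the tuple; if it is in D, it is therefore a coordinate,
    and equality with a coordinate is preserved. *)
Lemma submatching_pred (N1 N2 : structure L) (D1 : set N1) (D2 : set N2) n
    (v : 'I_n -> N1) (w : 'I_n -> N2) (t : term L n) : submatching D1 D2 v w ->
  D1 (eval v t) -> D2 (eval w t).
Proof.
move=> [V [h [v' [w' [m ve we]]]]]; have [[fv fw] vw e gv gw] := m => Dt.
pose eqt (i : V) (N : structure L) (u : V -> N) := eval (u \o h) t = u i.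
have deqt i : defn (eqt i).
  exists n.+1, (Equal (ren_term (lift ord0) t) (Var ord0)), (vcons i h) => N u /=.
  rewrite eval_ren vcons0 /eqt (_ : (u \o vcons i h) \o lift ord0 = u \o h) //.
  by apply/funext => j /=; rewrite vconsS.
have [|i _ vi] := free_tuple_acl gv Dt.
  apply/aclP; exists [set eval v t]; split => //.
  have de : defn (fun (N : structure L) (u : option V -> N) => eval (u \o (Some \o h)) t = u None).
    exists n.+1, (Equal (ren_term (lift ord0) t) (Var ord0)), (vcons None (Some \o h)) => N u /=.
    rewrite eval_ren vcons0 (_ : (u \o vcons _ _) \o lift ord0 = u \o (Some \o h)) //.
    by apply/funext => j /=; rewrite vconsS.
  have := pdef_defn (A := range v') (v := v') de (fun i => ex_intro2 _ _ i I erefl).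
  by apply: pdef_iff => x; rewrite ve; split => [->|->].
have : eqt i N1 v' by rewrite /eqt -ve.
move=> /(tpeq_defn vw (deqt i)); rewrite /eqt -we => ->.
by apply/e; rewrite vi.
Qed.

Lemma submatching_sat (N1 N2 : structure L) (D1 : set N1) (D2 : set N2) :
  H_structure T D1 -> H_structure T D2 ->
  forall n (phi : formula (add_pred L) n) (v : 'I_n -> N1) (w : 'I_n -> N2),
  submatching D1 D2 v w -> @sat _ (expand D1) n phi v <-> @sat _ (expand D2) n phi w.
Proof.
move=> H1 H2 n; elim=> {n} [n|n s t|n r ts|n p IHp q IHq|n p IHp] v w vw /=.
- by [].
- rewrite !eval_reduct.
  exact: (submatching_tpeq vw (Equal (term_reduct s) (term_reduct t)) id).
- case: r ts => [r|] ts /=.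
    have E (N : structure L) (D : set N) (u : 'I_n -> N) :
        (fun i => @eval _ (expand D) n u (ts i)) = (fun i => eval u (term_reduct (ts i))).
      by apply/funext => i; exact: eval_reduct.
    rewrite !E; exact: (submatching_tpeq vw (Rel r (fun i => term_reduct (ts i))) id).
  rewrite !eval_reduct; split; first exact: submatching_pred.
  by apply: submatching_pred; exact: submatching_sym.
- by rewrite (IHp v w vw) (IHq v w vw).
- have cE (N : structure L) (a : N) (u : 'I_n -> N) : vcons a u = ext a u \o unlift ord0 by [].
  split=> [all b|all a].
    have [a ba] := submatching_forth H2 H1 b (submatching_sym vw).
    have /IHp <- := submatching_comp (unlift ord0) (submatching_sym ba); exact: all.
  have [b ab] := submatching_forth H1 H2 a vw.
  have /IHp -> := submatching_comp (unlift ord0) ab; exact: all.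
Qed.

(** The system starts at the empty tuple: freeness is then independence of D, and equality of types
    is completeness of T. *)
Lemma H_structures_elem_equiv (N1 N2 : structure L) (D1 : set N1) (D2 : set N2) :
  H_structure T D1 -> H_structure T D2 -> elem_equiv (expand D1) (expand D2).
Proof.
move=> H1 H2 phi; apply: submatching_sat => //.
have r0 (X : Type) : range (@vnil X) = set0.
  by apply/seteqP; split => // x [[]].
have ind (N : structure L) (D : set N) : H_structure T D -> free_tuple D (@vnil N).
  by move=> [_ indD _ _] h Dh _; rewrite r0 set0U; exact: indD.
have tr (N N' : structure L) (D : set N) (D' : set N') : H_structure T D -> H_structure T D' ->
    forall n (psi : formula L n) (g : 'I_n -> 'I_0), sat psi (@vnil N \o g) -> sat psi (@vnil N' \o g).
  move=> [NT _ _ _] [NT' _ _ _] n psi g.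
  have n0 : n = 0 by case: n psi g => // n psi g; case: (g ord0).
  subst n; have gE (X : Type) : @vnil X \o g = @vnil X by apply/funext => -[].
  rewrite !gE; case: T_complete => _ /(_ psi) [/(_ N' NT') h _|/(_ N NT) nN /nN //].
  exact: h.
exists 'I_0, id, (@vnil N1), (@vnil N2); split => //; split.
- by rewrite !r0.
- by apply: tpeqP => m psi g; exact: (tr _ _ _ _ H1 H2).
- by case.
- exact: ind.
- exact: ind.
Qed.

End BackForth.

(** * Generic sequences *)

Section Construction.
Context (K : Type) (L : language) (T : theory L) (M : structure L).
Hypothesis K_inacc : strongly_inaccessible K.
Hypothesis M_monster : monster K T M.
Hypothesis T_complete : complete_theory T.
Hypothesis T_rank : SU_rank_one K T.

Let MT : models T M. Proof. by case: M_monster. Qed.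
Let M_sat : saturated K M. Proof. by case: M_monster. Qed.
Let exchange (A : set M) a b : acl (A `|` [set b]) a -> ~ acl A a -> acl (A `|` [set a]) b.
Proof. exact: (acl_exchange K_inacc M_monster T_complete T_rank MT). Qed.

Section Generic.
Context (I : Type) (lt : I -> I -> Prop).
Hypothesis lt_wo : well_order_rel lt.
Hypothesis lt_small : forall i, small K [set j | lt j i].

(** Each point also avoids the closure of the earlier base sets [C j]; by this, [x i] stays
    independent over [C i] from the points chosen after it. *)
Lemma generic_sequence (C : I -> set M) (F : I -> set_system M) :
  (forall i, small K (C i)) -> (forall i, Filter (F i)) ->
  (forall i X, F i X -> infinite_set X) ->
  exists x : I -> M, forall i, (forall X, pdef (C i) X -> F i X -> X (x i)) /\
    ~ acl (\bigcup_(j in [set j | lt j i]) ([set x j] `|` C j) `|` C i) (x i).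
Proof.
move=> sC FF Finf; have [m0] := carrier_inhabited M.
pose B i (g : forall j, lt j i -> M) : set M :=
  [set m | exists j (ji : lt j i), m = g j ji \/ C j m] `|` C i.
pose G i (g : forall j, lt j i -> M) : M :=
  eps m0 [set a | (forall X, pdef (C i) X -> F i X -> X a) /\ ~ acl (B i g) a].
pose x := Fix (wo_wf lt_wo) (fun _ => M) G.
have xE i : x i = eps m0 [set a | (forall X, pdef (C i) X -> F i X -> X a) /\
    ~ acl (\bigcup_(j in [set j | lt j i]) ([set x j] `|` C j) `|` C i) a].
  rewrite /x Fix_eq => [|{}i g h gh].
    congr eps; rewrite (_ : B i _ = \bigcup_(j in [set j | lt j i]) ([set x j] `|` C j) `|` C i) //.
    congr setU; apply/seteqP; split => [m [j [ji mj]]|m [j ji mj]]; first by exists j.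
    by exists j, ji.
  have -> // : g = h by apply/functional_extensionality_dep => j; apply/functional_extensionality_dep => ji; exact: gh.
exists x => i.
set B' := _ `|` C i.
have sB : small K B'.
  apply: small_setU => //; apply: small_bigcup => // j _; apply: small_setU => //.
  exact/small_finite/finite_set1.
have [a aP] := sat_filter_acl K_inacc M_sat (sC i) sB (FF i) (Finf i).
rewrite (xE i).
exact: (epsP m0 (ex_intro (fun a => (forall X, pdef (C i) X -> F i X -> X a) /\ ~ acl B' a) a aP)).
Qed.

Lemma wo_max_finite (E : set I) : finite_set E -> E !=set0 ->
  exists2 m, E m & forall j, E j -> j = m \/ lt j m.
Proof.
move=> fE; have [s sE] : exists s : seq {classic I}, E = [set` s] by apply/finite_seqP.
rewrite {}sE {fE}; elim: s => [|i s IH]; first by rewrite set_nil => -[].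
move=> _; have [ne|e] := pselect (([set` s] : set I) !=set0); last first.
  exists i => [|j]; first by rewrite /mkset in_cons eqxx.
  rewrite /mkset in_cons => /orP [/eqP ->|js]; first by left.
  by case: e; exists j.
have [m ms mM] := IH ne.
have [im|im|mi] := wo_total lt_wo i m.
- exists m => [|j]; first by rewrite /mkset in_cons; apply/orP; right.
  by rewrite /mkset in_cons => /orP [/eqP ->|/mM]; [right|].
- exists m => [|j]; first by rewrite /mkset in_cons; apply/orP; right.
  by rewrite /mkset in_cons => /orP [/eqP ->|/mM]; [left|].
- exists i => [|j]; first by rewrite /mkset in_cons eqxx.
  rewrite /mkset in_cons => /orP [/eqP ->|/mM [->|jm]]; [by left|by right|right].
  exact: (wo_trans lt_wo) jm mi.
Qed.

Context (C : I -> set M) (x : I -> M).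
Hypothesis x_generic : forall i,
  ~ acl (\bigcup_(j in [set j | lt j i]) ([set x j] `|` C j) `|` C i) (x i).

Lemma acl_image_last (A : set M) (J : set I) a : acl (A `|` x @` J) a ->
  acl A a \/ exists2 m, J m & acl (A `|` x @` [set j | J j /\ (j = m \/ lt j m)]) a.
Proof.
move=> /acl_finite [B [fB BAJ Ba]].
have [nA|all] := pselect (exists b, B b /\ ~ A b); last first.
  left; apply: acl_sub Ba => b Bb; apply: contrapT => nAb; apply: all.
  by exists b.
have [b0 [Bb0 nAb0]] := nA.
have [j0 Jj0 xj0] : (x @` J) b0 by case: (BAJ b0 Bb0).
have /choice [h hP] : forall b, exists j, B b -> ~ A b -> J j /\ x j = b.
  move=> b; have [Bb|nB] := pselect (B b); last by exists j0.
  have [Ab|[j Jj xj]] := BAJ b Bb; first by exists j0.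
  by exists j.
have fE : finite_set (h @` (B `\` A)) by apply: finite_image; exact: finite_setD.
have [|m [b [Bb nAb] hb] mM] := wo_max_finite fE; first by exists (h b0), b0.
right; exists m; first by rewrite -hb; have [] := hP b Bb nAb.
apply: acl_sub Ba => c Bc; have [Ac|nAc] := pselect (A c); first by left.
right; have [Jc xc] := hP c Bc nAc; exists (h c) => //; split => //.
by apply: mM; exists c.
Qed.

(** Take the least m such that [x i] depends on [C i] and the other terms up to m. If m is not above
    i, genericity at i fails. Otherwise exchange makes [x m] depend on [C i] and earlier terms, and
    genericity at m fails. *)
Lemma generic_independent i : ~ acl (C i `|` x @` [set j | j <> i]) (x i).
Proof.
have base A : A `<=` \bigcup_(j in [set j | lt j i]) ([set x j] `|` C j) `|` C i ->
    ~ acl A (x i).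
  by move=> sub h; apply: (x_generic (i := i)); exact: acl_sub h.
have baseC : ~ acl (C i) (x i) by apply: base => c; right.
move=> /acl_image_last [//|[m0 _ am0]].
have [m [am mM]] := wo_min lt_wo
  (ex_intro (fun m => acl (C i `|` x @` [set j | j <> i /\ (j = m \/ lt j m)]) (x i)) m0 am0).
have low : m = i \/ lt m i -> False.
  move=> mi; apply: base am => c [Cc|[j [ji jm] <-]]; first by right.
  left; exists j; last by left.
  case: mi jm => [-> [//|//]|mi [->//|jm]]; exact: (wo_trans lt_wo) jm mi.
have [mi|mi|im] := wo_total lt_wo m i; [by apply: low; right|by apply: low; left|].
pose A := C i `|` x @` [set j | j <> i /\ lt j m].
have nA : ~ acl A (x i).
  move=> /acl_image_last [//|[m' [_ m'm] am']]; apply: (mM m' m'm).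
  by apply: acl_sub am' => c [Cc|[j [[? ?] ?] <-]]; [left|right; exists j].
have Am : acl (A `|` [set x m]) (x i).
  apply: acl_sub am => c [Cc|[j [ji [->|jm]] <-]]; [by left; left|by right|].
  by left; right; exists j.
apply: (x_generic (i := m)); apply: acl_sub (exchange Am nA) => c [[Cc|[j [_ jm] <-]]|->].
- by left; exists i => //; right.
- by left; exists j => //; left.
- by left; exists i => //; left.
Qed.

Lemma generic_inj : injective x.
Proof.
move=> i j xij; apply: contrapT => ij; apply: (@generic_independent i).
by apply: acl_refl; right; exists j => // /esym.
Qed.

Lemma generic_alg_independent (J : set I) : alg_independent (x @` J).
Proof.
move=> _ [i Ji <-] xi; apply: (@generic_independent i); apply: acl_sub xi.
move=> _ [[j Jj <-] ji]; right; exists j => // e; apply: ji.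
by rewrite e.
Qed.

End Generic.

Definition independent_over (A Y : set M) : Prop :=
  forall y, Y y -> ~ acl (A `|` Y `\ y) y.

(** If a creates a dependence, exchange puts a into the closure of A and the finite support Z of
    that dependence, so a does no harm to the rest of Y. *)
Lemma independent_over_add (A Y : set M) a : independent_over A Y ->
  exists Z, finite_set Z /\ independent_over (A `|` [set a]) (Y `\` Z).
Proof.
move=> ind; have [|nind] := pselect (independent_over (A `|` [set a]) Y).
  by move=> indY; exists set0; rewrite setD0.
have [y [Yy ay]] : exists y, Y y /\ acl ((A `|` [set a]) `|` Y `\ y) y.
  apply: contrapT => no; apply: nind => y Yy ay; apply: no.
  by exists y.
have [B [fB Bs By]] := acl_finite ay.
pose Z := (B `&` Y) `|` [set y]; exists Z; split.
  by rewrite finite_setU; split; [exact: finite_setIl|exact: finite_set1].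
have Za : acl (A `|` Z) a.
  have : acl ((A `|` (Z `\ y)) `|` [set y]) a.
    apply: exchange; last first.
      by apply: contra_not (ind y Yy); apply: acl_sub => z [Az|[[[Bz Yz]|->] zy]];
        [left|right|case: zy].
    apply: acl_sub By => z Bz; have [[Az|->]|[Yz zy]] := Bs z Bz.
    + by left; left.
    + by right.
    + by left; right; split => //; left.
  by apply: acl_sub => z [[Az|[Zz _]]|->]; [left|right|right; right].
move=> z [Yz nZz] az; apply: (ind z Yz); apply: (@acl_trans1 _ _ _ _ a).
  by apply: acl_sub az => t [[At|->]|[[Yt _] tz]]; [left; left|right|left; right].
apply: acl_sub Za => t [At|Zt]; first by left.
right; split; last by move=> tz; apply: nZz; rewrite -tz.
by case: Zt => [[]//|->].
Qed.

Lemma independent_over_finite (A Y E : set M) : independent_over A Y -> infinite_set Y ->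
  finite_set E -> exists2 y, Y y & ~ acl (A `|` E) y.
Proof.
move=> ind Yinf fE; have [s sE] : exists s : seq {classic M}, E = [set` s] by apply/finite_seqP.
rewrite {}sE {fE}; elim: s A Y ind Yinf => [|a s IH] A Y ind Yinf.
  have [y Yy] := infinite_setN0 Yinf; exists y => // ay.
  apply: (ind y Yy); apply: acl_sub ay => z; rewrite set_nil.
  by case=> // Az; left.
have [Z [fZ indZ]] := independent_over_add a ind.
have [|y [Yy _] ny] := IH _ _ indZ; first exact: infinite_setD.
exists y => //; apply: contra_not ny; apply: acl_sub => z [Az|]; first by left; left.
rewrite /mkset in_cons => /orP [/eqP ->|zs]; [by left; right|by right].
Qed.

Lemma H_structure_intro (D : set M) : alg_independent D ->
  (forall (A : set M) b, finite_set A -> ~ acl A b -> exists a, D a /\ same_over A b a) ->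
  (forall (A : set M) b, finite_set A -> ~ acl A b ->
     exists a, same_over A b a /\ ~ acl (A `|` D) a) -> H_structure T D.
Proof.
move=> indD dens extn.
have real (A : set M) (q : set (pformula M 1)) : finite_set A -> complete_type A q ->
    nonalgebraic_type q -> exists b, ~ acl A b /\
      forall a, same_over A b a -> realizes q (fun=> a).
  move=> fA cq naq; have [_ /(_ A q (small_finite K_inacc fA) cq) [y yq]] := M_sat.
  have yE : y = fun=> y ord0 by apply/funext => i; rewrite ord1.
  exists (y ord0); split => [[phi [phiA alg sy]]|a ya phi qphi].
    have [_ _ /(_ phi phiA) [/naq//|/yq]] := cq.
    by rewrite yE; apply.
  have [/(_ phi qphi) phiA _ _] := cq.
  by apply: (ya _ (pdef_psat phiA)); rewrite /mkset -yE; exact: yq.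
split => // A q fA cq naq; have [b [nb bP]] := real A q fA cq naq.
  by have [a [Da ba]] := dens A b fA nb; exists a; split => //; exact: bP.
by have [a [ba na]] := extn A b fA nb; exists a; split => //; exact: bP.
Qed.

(** * Global types *)

(** A complete non-algebraic type over M, given by its definable sets. *)
Definition global_type (g : set_system M) : Prop :=
  [/\ forall X, g X -> pdef setT X, forall X Y, g X -> g Y -> g (X `&` Y),
      forall X, pdef setT X -> g X \/ g (~` X) & forall X, g X -> infinite_set X].

Lemma global_type_ext (F : set_system M) : Filter F -> (forall X, F X -> infinite_set X) ->
  exists g, global_type g /\ forall X, pdef setT X -> F X -> g X.
Proof.
move=> FF Finf; have [U [Uultra FU Uinf]] := nonprincipal_ultrafilter FF Finf.
have UF : ProperFilter U by exact: ultra_proper.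
exists [set X | pdef setT X /\ U X]; split; last by move=> X dX /FU.
split=> [X []//|X Y [dX UX] [dY UY]|X dX|X [_ /Uinf]//].
  by split; [exact: pdefI|exact: filterI].
by case: (in_ultra_setVsetC X Uultra) => UX; [left|right; split => //; exact: pdefC].
Qed.

Lemma global_type_sep (g h : set_system M) : global_type g -> global_type h -> g <> h ->
  exists X, g X /\ h (~` X).
Proof.
move=> [gd gI gc ginf] [hd hI hc hinf] gh.
have [[X [gX nhX]]|no] := pselect (exists X, g X /\ ~ h X).
  by exists X; split => //; case: (hc X (gd X gX)).
have [[X [hX ngX]]|no'] := pselect (exists X, h X /\ ~ g X).
  by exists (~` X); rewrite setCK; split => //; case: (gc X (hd X hX)).
case: gh; apply/seteqP; split => X ?; apply: contrapT => ?.
  by apply: no; exists X.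
by apply: no'; exists X.
Qed.

Lemma separating_parameters (S : Type) (g : S -> set_system M) : small K [set: S] ->
  injective g -> (forall s, global_type (g s)) ->
  exists C : set M, small K C /\ forall s t, s <> t ->
    exists X, [/\ pdef C X, g s X & g t (~` X)].
Proof.
move=> sS gI gG.
have /choice [B BP] : forall p : S * S, exists B : set M, small K B /\
    (p.1 <> p.2 -> exists X, [/\ pdef B X, g p.1 X & g p.2 (~` X)]).
  move=> [s t]; have [e|st] := pselect (s = t).
    by exists set0; split => //; exact/small_finite/finite_set0.
  have [X [gX hX]] : exists X, g s X /\ g t (~` X).
    by apply: global_type_sep => // /gI.
  have [B [fB _ dX]] : exists B : set M, [/\ finite_set B, B `<=` setT & pdef B X].
    by apply: pdef_params; case: (gG s) => + _ _ _; apply.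
  by exists B; split => [|_]; [exact: small_finite|exists X].
exists (\bigcup_(p in [set: S * S]) B p); split.
  by apply: small_bigcup => // [|p _]; [exact: small_prod|case: (BP p)].
move=> s t st; have [_ /(_ st) [X [dX gX hX]]] := BP (s, t).
by exists X; split => //; apply: pdef_sub dX => b Bb; exists (s, t).
Qed.

Definition restrict_type (C : set M) (g : set_system M) : set_system M :=
  filter_from [set X | pdef C X /\ g X] id.

Lemma restrict_type_filter C g : global_type g -> Filter (restrict_type C g).
Proof.
move=> [gd gI gc ginf]; apply: filter_from_filter.
  exists setT; split; first exact: pdefT.
  case: (gc setT) => [||/ginf]; [exact: pdefT|by []|].
  by rewrite setCT => /(_ (finite_set0 _)).
by move=> X Y [dX gX] [dY gY]; exists (X `&` Y) => //; split; [exact: pdefI|exact: gI].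
Qed.

Lemma restrict_type_infinite C g X : global_type g -> restrict_type C g X -> infinite_set X.
Proof.
move=> [_ _ _ ginf] [Y [_ /ginf Yinf] YX] fX; apply: Yinf; exact: sub_finite_set fX.
Qed.

(* All types over C are stationary, so D need only contain, for each of the few
   global types, infinitely many independent realizations of its restriction. *)
Lemma small_H_structure : small K [set g | global_type g] ->
  exists D : set M, H_structure T D /\ small K D.
Proof.
move=> sG; pose G : Type := [set g | global_type g]; pose gv (g : G) : set_system M := val g.
have gvP g : global_type (gv g) by have := valP g => /set_mem.
have sG' : small K [set: G] by exact: (iffLR (small_set_type _ _) sG).
have [C [sC sep]] := separating_parameters sG' val_inj gvP.
have [lt lt_wo] := wo_exists (G * nat).
have sI : small K [set: G * nat] by apply: small_prod => //; exact: small_nat.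
have lt_small i : small K [set j | lt j i] by exact: small_subT.
have [x xP] := generic_sequence lt_wo lt_small (fun i => sC)
  (fun i => restrict_type_filter C (gvP i.1)) (fun i X => @restrict_type_infinite C _ X (gvP i.1)).
have xg i := proj2 (xP i).
have sD : small K (range x) by exact: small_range.
exists (range x); split => //; apply: H_structure_intro.
- exact: (generic_alg_independent lt_wo xg).
- move=> A b fA nb.
  have [g [gG gb]] := global_type_ext (type_filter_filter A b) (type_filter_infinite nb).
  pose g' : G := SigSub (mem_set gG).
  have [y [n _ <-] ny] : exists2 y, range (fun n => x (g', n)) y & ~ acl (C `|` A) y.
    apply: independent_over_finite => //.
    + move=> _ [n _ <-] nn; apply: (generic_independent lt_wo xg (i := (g', n))).
      apply: acl_sub nn => z [Cz|[[m _ <-] mn]]; [by left|right].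
      by exists (g', m) => // -[e]; apply: mn; rewrite e.
    + apply/infiniteP; apply: (@card_le_inj _ _ _ _ (fun n => x (g', n))) => [n _|m n _ _].
        by exists n.
      by move=> /(generic_inj lt_wo xg) -[].
  exists (x (g', n)); split; first by exists (g', n).
  (* A global extension h of the type of the chosen point over C and A agrees with g over C, hence
     equals g; so the point has the type of b over A. *)
  have [h [hG hx]] := global_type_ext (type_filter_filter (C `|` A) (x (g', n)))
    (type_filter_infinite ny).
  have hh : g = h.
    apply: contrapT => gh; pose h' : G := SigSub (mem_set hG).
    have [|X [dX gX hX]] := sep g' h'; first by move=> /(congr1 val).
    have hX' : h X.
      apply: hx; first by apply: pdef_sub dX.
      exists X => //; split; first by apply: pdef_sub dX => c; left.
      by have [+ _] := xP (g', n); apply => //; exists X.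
    have [_ hI _ hinf] := hG; have := hinf _ (hI _ _ hX' hX).
    by rewrite setICr; apply; exact: finite_set0.
  move=> X dX Xb; apply: contrapT => nX.
  have gX : g X by apply: gb; [exact: pdef_sub dX|exists X].
  have gnX : g (~` X).
    rewrite hh; apply: hx; first by apply: pdefC; exact: pdef_sub dX.
    by exists (~` X) => //; split => //; apply: pdefC; apply: pdef_sub dX => c; right.
  have [_ gI _ ginf] := gG; have := ginf _ (gI _ _ gX gnX).
  by rewrite setICr; apply; exact: finite_set0.
(* As D is small, a realization can avoid the closure of A and D by saturation alone. *)
- move=> A b fA nb; apply: (same_over_ext K_inacc M_sat) => //; first exact: small_finite.
  by apply: small_setU => //; exact: small_finite.
Qed.

End Construction.

(** * Omitting the restriction of a global type *)

Lemma range_nth (X : eqType) (e : X) (s : seq X) :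
  range (nth e (e :: s)) = [set e] `|` [set` s].
Proof.
apply/seteqP; split => [_ [n _ <-]|x [->|xs]].
- case: n => [|n] /=; first by left.
  by have [ns|ns] := ltnP n (size s); [right; exact: mem_nth|left; rewrite nth_default].
- by exists 0.
- by exists (index x s).+1 => //=; exact: nth_index.
Qed.

Section ManyTypes.
Context (K : Type) (L : language) (T : theory L) (M : structure L).
Hypothesis K_inacc : strongly_inaccessible K.
Hypothesis L_small : small K [set: symbols L].
Hypothesis M_monster : monster K T M.
Hypothesis T_complete : complete_theory T.
Hypothesis T_rank : SU_rank_one K T.

Let M_sat : saturated K M. Proof. by case: M_monster. Qed.

Lemma monster_infinite : infinite_set [set: M].
Proof.
move=> fM; have [_ nKM] := small_finite K_inacc fM; apply: nKM.
by case: M_sat => /card_esym /card_eq_leW.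
Qed.

(* Otherwise every restriction of one of these global types would be implied,
   up to algebraicity, by a type over a countable set. *)
Lemma unimplied_type : ~ small K [set g : set_system M | global_type g] ->
  exists (C : set M) (g : set_system M), [/\ small K C, global_type g &
    forall (u : nat -> M) b, ~ acl (range u) b ->
    exists Z, [/\ pdef C Z, g Z & forall X, pdef (range u) X -> X b -> infinite_set (X `\` Z)]].
Proof.
move=> /not_smallP KG.
have [S [sS nS]] := no_large_almost_disjoint_family K_inacc L_small M_monster T_complete T_rank.
have [g [gG gI']] := card_le_inj_ex (set0 : set_system M) (card_le_trans (proj1 sS) KG).
have gI : injective g by move=> s t; exact: gI'.
have [C [sC sep]] := separating_parameters K_inacc sS gI (fun s => gG s I).
apply: contrapT => no.
have /choice [ub ubP] : forall s, exists p : (nat -> M) * M, ~ acl (range p.1) p.2 /\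
    forall Z, pdef C Z -> g s Z -> exists X, [/\ pdef (range p.1) X, X p.2 & finite_set (X `\` Z)].
  move=> s; apply: contrapT => nos; apply: no; exists C, (g s); split => //; first exact: gG.
  move=> u b nub; apply: contrapT => noZ; apply: nos; exists (u, b); split => // Z dZ gZ.
  apply: contrapT => noX; apply: noZ; exists Z; split => // X dX Xb fX; apply: noX.
  by exists X.
apply: (nS (fun s => (ub s).1) (fun s => (ub s).2)) => [s|s t st]; first by case: (ubP s).
have [Z [dZ gZ gZ']] := sep s t st.
have [_ /(_ Z dZ gZ) [X [dX Xs fX]]] := ubP s.
have [_ /(_ _ (pdefC dZ) gZ') [Y [dY Yt fY]]] := ubP t.
exists X, Y; split => //.
apply: (@sub_finite_set _ _ ((X `\` Z) `|` (Y `\` ~` Z))); last by rewrite finite_setU.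
move=> m [Xm Ym]; have [Zm|nZm] := pselect (Z m); last by left.
by right; split => // /(_ Zm).
Qed.

Lemma omitting_H_structure : ~ small K [set g : set_system M | global_type g] ->
  exists (D C : set M) (g : set_system M), [/\ H_structure T D, small K C, global_type g &
    forall d, D d -> exists X, [/\ pdef C X, g X & ~ X d]].
Proof.
move=> /unimplied_type [C [g [sC gG gP]]].
have Minf := monster_infinite.
have [m0 _] := infinite_setN0 Minf.
have [m1 [_ m10]] : exists m1, (setT `\ m0) m1.
  have : infinite_set ([set: M] `\ m0) by apply: infinite_setD => //; exact: finite_set1.
  exact: infinite_setN0.
have [lt [lt_wo lt_small]] : exists lt : seq M -> seq M -> Prop,
    well_order_rel lt /\ forall x, small K [set y | lt y x].
  by apply: exists_small_wo_seq => //; case: M_sat => /card_eq_leW.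
(* The task f :: b :: e :: c asks for a realization of the type of b over e :: c,
   to be put in D if f = m0 and to be kept outside acl(c, D) if f = m1. *)
have /choice [CF CFP] : forall s : seq M, exists p : set M * set_system M,
    [/\ small K p.1, Filter p.2, (forall X, p.2 X -> infinite_set X) &
    forall f b e c, s = [:: f, b, e & c] -> ~ acl (range (nth e (e :: c))) b ->
      [/\ range (nth e (e :: c)) `<=` p.1,
          (forall X, pdef (range (nth e (e :: c))) X -> X b -> p.2 X) &
          f = m0 -> exists Z, [/\ pdef C Z, g Z, pdef p.1 Z & p.2 (~` Z)]]].
  move=> s.
  have [[f [b [e [c [sE nb]]]]]|no] := pselect (exists f b e c, s = [:: f, b, e & c] /\
      ~ acl (range (nth e (e :: c))) b); last first.
    (* A list that codes no task receives just a generic point; the trivial filter qualifies because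
       M is infinite. *)
    exists (set0, [set setT]); split.
    - exact/small_finite/finite_set0.
    - by split => [|X Y -> ->|X Y XY XT] //=; [rewrite setIT|rewrite -subTset -XT].
    - by move=> X ->.
    - by move=> f b e c sE nb; case: no; exists f, b, e, c.
  have su : small K (range (nth e (e :: c))) by apply: small_range => //; exact: small_nat.
  have [fm|fm] := pselect (f = m0); last first.
    exists (range (nth e (e :: c)), type_filter (range (nth e (e :: c))) b); split => //.
    - exact: type_filter_filter.
    - exact: type_filter_infinite.
    - move=> f' b' e' c'; rewrite sE => -[<- <- <- <-] _; split => // X dX Xb.
      by exists X.
  (* Every set in the type of b has infinitely many points outside this Z, so avoiding Z is
     consistent with the task. C joins the base set to make Z definable over it. *)
  have [Z [dZ gZ Zinf]] := gP _ b nb.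
  exists (range (nth e (e :: c)) `|` C,
    filter_from [set X | pdef (range (nth e (e :: c))) X /\ X b] (fun X => X `\` Z)); split.
  - exact: small_setU.
  - apply: filter_from_filter; first by exists setT; split => //; exact: pdefT.
    move=> X Y [dX Xb] [dY Yb]; exists (X `&` Y); first by split => //; exact: pdefI.
    by move=> x [[Xx Yx] nZ].
  - by move=> Y [X [dX Xb] XY] fY; apply: (Zinf X dX Xb); exact: sub_finite_set fY.
  - move=> f' b' e' c'; rewrite sE => -[<- <- <- <-] _; split => [x ux|X dX Xb|_]; first by left.
      by exists X => // x [].
    exists Z; split => //; first by apply: pdef_sub dZ => x; right.
    by exists setT => [|x []//]; split => //; exact: pdefT.
have [x xP] := generic_sequence K_inacc M_monster lt_wo lt_small
  (C := fun s => (CF s).1) (F := fun s => (CF s).2)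
  (fun s => let: And4 h _ _ _ := CFP s in h) (fun s => let: And4 _ h _ _ := CFP s in h)
  (fun s => let: And4 _ _ h _ := CFP s in h).
have xg s := proj2 (xP s).
pose J := [set s | exists b e c, s = [:: m0, b, e & c] /\ ~ acl (range (nth e (e :: c))) b].
have task f A b : finite_set A -> ~ acl A b -> exists s, [/\ A `<=` (CF s).1,
    same_over A b (x s), ohead s = Some f & f = m0 -> J s].
  move=> fA nb; have [t tE] : exists t : seq {classic M}, A = [set` t] by apply/finite_seqP.
  (* The list of a task is nonempty, so m0 is added to A; b may be algebraic over the larger set and
     is replaced by a conjugate that is not. *)
  have [b' [bb' nb']] : exists b', same_over A b b' /\ ~ acl (range (nth m0 (m0 :: t))) b'.
    apply: (same_over_ext K_inacc M_sat) => //; first exact: small_finite.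
    by apply: small_range => //; exact: small_nat.
  have At : A `<=` range (nth m0 (m0 :: t)).
    by rewrite (@range_nth {classic M}) tE => y; right.
  exists [:: f, b', m0 & t]; have [_ _ _ /(_ f b' m0 t erefl nb') [tC tF _]] := CFP [:: f, b', m0 & t].
  split => //; first exact: subset_trans tC.
    move=> X dX Xb; have [+ _] := xP [:: f, b', m0 & t]; apply.
      by apply: pdef_sub dX; exact: subset_trans tC.
    by apply: tF; [exact: pdef_sub dX|exact: bb'].
  by move=> ->; exists b', m0, t.
exists (x @` J), C, g; split => //.
  apply: H_structure_intro.
  - exact: K_inacc.
  - exact: M_monster.
  - exact: (generic_alg_independent K_inacc M_monster T_complete T_rank lt_wo xg).
  - move=> A b fA nb; have [s [_ bs _ /(_ erefl) Js]] := task m0 A b fA nb.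
    by exists (x s); split => //; exists s.
  - move=> A b fA nb; have [s [As bs hs _]] := task m1 A b fA nb.
    exists (x s); split => // xs.
    (* The head m1 keeps s out of J, so all points of D are terms with an index other than s. *)
    apply: (generic_independent K_inacc M_monster T_complete T_rank lt_wo xg (i := s)).
    apply: acl_sub xs => y [/As|[t [b' [e [c [tE _]]]] <-]]; first by left.
    by right; exists t => // ts; move: hs; rewrite -ts tE => -[] /esym.
move=> _ [s [b [e [c [sE nb]]]] <-].
have [_ _ _ /(_ m0 b e c sE nb) [_ _ /(_ erefl) [Z [dZ gZ dZ' FZ]]]] := CFP s.
by exists Z; split => //; exact: (proj1 (xP s) _ (pdefC dZ') FZ).
Qed.

End ManyTypes.

(** * Saturation of expansions *)

Section Expansion.
Context (L : language).

Fixpoint term_expand n (t : term L n) : term (add_pred L) n :=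
  match t with
  | Var i => Var i
  | App f ts => @App (add_pred L) n f (fun i => term_expand (ts i))
  end.

Fixpoint formula_expand n (phi : formula L n) : formula (add_pred L) n :=
  match phi in formula _ n return formula (add_pred L) n with
  | Falsum _ => Falsum
  | Equal _ s t => Equal (term_expand s) (term_expand t)
  | Rel _ r ts => @Rel (add_pred L) _ (Some r) (fun i => term_expand (ts i))
  | Imp _ p q => Imp (formula_expand p) (formula_expand q)
  | All _ p => All (formula_expand p)
  end.

Lemma eval_expand (N : structure L) (D : set N) n (v : 'I_n -> N) (t : term L n) :
  @eval _ (expand D) n v (term_expand t) = eval v t.
Proof.
elim: t => [//|f ts IH] /=; congr (fun_interp N f _); apply/funext => i; exact: IH.
Qed.

Lemma sat_expand (N : structure L) (D : set N) n (phi : formula L n) (v : 'I_n -> N) :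
  @sat _ (expand D) n (formula_expand phi) v <-> sat phi v.
Proof.
elim: phi v => {n} [n|n s t|n r ts|n p IHp q IHq|n p IHp] v /=.
- by [].
- by rewrite !eval_expand.
- rewrite (_ : (fun i => @eval _ (expand D) n v (term_expand (ts i))) = fun i => eval v (ts i)) //.
  by apply/funext => i; exact: eval_expand.
- by rewrite IHp IHq.
- by split=> all a; apply/IHp; exact: all.
Qed.

Lemma pdef_expand (N : structure L) (D A X : set N) : pdef A X -> @pdef _ (expand D) A X.
Proof.
move=> [phi [phiA Xphi]].
exists (@PFormula _ (expand D) 1 _ (formula_expand (pbody phi)) (pparam phi)); split => // a.
by rewrite Xphi /psat /= sat_expand.
Qed.

Lemma pdef_predicate (N : structure L) (D A : set N) : @pdef _ (expand D) A D.
Proof.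
apply/pdefP; exists (fun (N' : structure (add_pred L)) v =>
  rel_interp N' (None : rels (add_pred L)) (fun=> v None)); split => //.
by exists 1, (@Rel (add_pred L) 1 None (fun=> Var ord0)), (fun=> None).
Qed.

Lemma isomorphism_eval (N1 N2 : structure L) (h : N1 -> N2) n (v : 'I_n -> N1) (t : term L n) :
  isomorphism h -> h (eval v t) = eval (h \o v) t.
Proof.
move=> [_ hf _]; elim: t => [//|f ts IH] /=.
by rewrite hf; congr fun_interp; apply/funext => i; exact: IH.
Qed.

Lemma isomorphism_sat (N1 N2 : structure L) (h : N1 -> N2) n (phi : formula L n)
    (v : 'I_n -> N1) : isomorphism h -> sat phi v <-> sat phi (h \o v).
Proof.
move=> hiso; have [[k hk kh] _ hr] := hiso.
elim: phi v => {n} [n|n s t|n r ts|n p IHp q IHq|n p IHp] v /=.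
- by [].
- rewrite -!isomorphism_eval //; split=> [->//|]; exact: (can_inj hk).
- rewrite hr (_ : h \o _ = fun i => eval (h \o v) (ts i)) //.
  by apply/funext => i /=; rewrite isomorphism_eval.
- by rewrite IHp IHq.
- have hc a : h \o vcons a v = vcons (h a) (h \o v).
    by apply/funext => i /=; rewrite /vcons; case: (unlift ord0 i).
  split=> all a; last by apply/IHp; rewrite hc; exact: all.
  by rewrite -(kh a) -hc; apply/IHp; exact: all.
Qed.

Lemma isomorphism_pdef (N1 N2 : structure L) (h : N1 -> N2) (A Y : set N2) :
  isomorphism h -> pdef A Y -> pdef (h @^-1` A) (h @^-1` Y).
Proof.
move=> hiso [phi [phiA Yphi]]; have [[k hk kh] _ _] := hiso.
exists (PFormula (pbody phi) (k \o pparam phi)); split => [i|a].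
  by rewrite /preimage /= kh; exact: phiA.
rewrite /preimage /= Yphi /psat /= (isomorphism_sat _ _ hiso) comp_vcat.
by rewrite (_ : h \o (k \o pparam phi) = pparam phi) //; apply/funext => i /=; rewrite kh.
Qed.

End Expansion.

(** Density makes the type finitely satisfiable in D. Saturation is known for (M,H), so the type
    together with the predicate is pulled back along h, realized there, and the realization is sent
    to (M,D). *)
Lemma H_structure_type_in (K : Type) (L : language) (T : theory L) (M : structure L)
    (H D C : set M) (F : set_system M) :
  strongly_inaccessible K -> saturated K M -> saturated K (expand H) ->
  isomorphic (expand H) (expand D) -> H_structure T D -> small K C -> Filter F ->
  (forall X, F X -> infinite_set X) ->
  exists d, D d /\ forall X, pdef C X -> F X -> X d.
Proof.
move=> K_inacc M_sat H_sat [h hiso] [_ _ dens _] sC FF Finf.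
have [[k hk kh] _ _] := hiso.
have meet X : pdef C X -> F X -> exists d, D d /\ X d.
  move=> dX FX; have [B [fB _ [phi [phiB Xphi]]]] := pdef_params dX.
  have FF' : Filter (filter_from [set: unit] (fun=> X)).
    by apply: filter_from_filter => [|i j _ _]; [exists tt|exists tt].
  have sB := small_finite K_inacc fB.
  have [|b [bX nb]] := sat_filter_acl K_inacc M_sat sB sB FF'.
    by move=> Y [_ _ XY] fY; apply: (Finf X FX); exact: sub_finite_set fY.
  have Xb : X b by apply: bX; [exists phi|exists tt].
  have [psi [oB sb] alg|d [Dd dq]] := dens B (type_of B b) fB (complete_type_of B b).
    by apply: nb; exists psi.
  by exists d; split => //; apply/Xphi; apply: dq; split => //; exact/Xphi.
pose G : set_system M := filter_from [set X | pdef C X /\ F X] (fun X => h @^-1` (X `&` D)).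
have GF : ProperFilter G.
  apply: filter_from_proper; last first.
    move=> X [dX FX]; have [d [Dd Xd]] := meet X dX FX.
    by exists (k d); rewrite /preimage /= kh.
  apply: filter_from_filter; first by exists setT; split; [exact: pdefT|exact: filterT].
  move=> X Y [dX FX] [dY FY]; exists (X `&` Y); first by split; [exact: pdefI|exact: filterI].
  by move=> m [[Xm Ym] Dm].
have sC' : small K (h @^-1` C).
  apply: small_sub (small_image k sC) _ => m Cm.
  by exists (h m) => //; exact: hk.
have [a aP] := sat_filter (M := expand H) H_sat sC' GF.
exists (h a); split => [|X dX FX].
  apply: (aP (h @^-1` D)); first exact: (isomorphism_pdef hiso (pdef_predicate D C)).
  by exists setT => [|m [] //]; split; [exact: pdefT|exact: filterT].
apply: (aP (h @^-1` X)); first exact: (isomorphism_pdef hiso (pdef_expand D dX)).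
by exists X => // m [].
Qed.

Theorem theorem3p1 (K : Type) (L : language) (T : theory L) (M : structure L)
    (H : set M)
    (K_inacc : strongly_inaccessible K)
    (L_small : [set: symbols L] #< [set: K])
    (T_complete : complete_theory T)
    (T_infinite : has_infinite_model T)
    (T_rank : SU_rank_one K T)
    (M_monster : monster K T M)
    (MH_monster : monster K (Tindep T) (expand H)) :
  elem_class H <> orbit_class H.
Proof.
move=> eo; have [MHT MH_sat] := MH_monster; have [_ M_sat] := M_monster.
have iso (D : set M) : H_structure T D -> isomorphic (expand H) (expand D).
  move=> HD; suff : elem_class H D by rewrite eo.
  (* All H-structures satisfy the same sentences as (M,D), so every sentence true in (M,D) belongs
     to [Tindep]; applied to negations this gives the converse. *)
  have up phi : holds (expand D) phi -> holds (expand H) phi.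
    move=> Dphi; apply: MHT => N D' HD'.
    by apply/(H_structures_elem_equiv K_inacc M_monster T_complete T_rank HD HD').
  move=> phi; split => [Hphi|]; last exact: up.
  by apply: contrapT => nD; exact: (up (Neg phi)).
have [few|many] := pselect (small K [set g : set_system M | global_type g]).
  have [D [HD sD]] := small_H_structure K_inacc M_monster T_complete T_rank few.
  pose F : set_system M := [set X | finite_set (~` X)].
  have FF : Filter F.
    split=> [|X Y fX fY|X Y XY fX]; rewrite /F /mkset.
    - by rewrite setCT; exact: finite_set0.
    - by rewrite setCI finite_setU.
    - by apply: sub_finite_set fX => x nY /XY.
  have [|d [Dd dP]] := H_structure_type_in K_inacc M_sat MH_sat (iso D HD) HD sD FF.
    move=> X fX fX'; apply: (monster_infinite K_inacc M_monster).
    by rewrite -(setUv X) finite_setU.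
  have : (~` [set d]) d.
    by apply: dP; [apply: pdefC; exact: pdef1|rewrite /F /mkset setCK; exact: finite_set1].
  by apply.
have [D [C [g [HD sC gG nD]]]] := omitting_H_structure K_inacc L_small M_monster T_complete T_rank many.
have [d [Dd dP]] := H_structure_type_in K_inacc M_sat MH_sat (iso D HD) HD sC
  (restrict_type_filter C gG) (fun X => @restrict_type_infinite L M C g X gG).
by have [X [dX gX]] := nD d Dd; apply; apply: dP => //; exists X.
Qed.
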